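(* (i) Let $J(\lambda)=J_{n_1}(\lambda)\oplus\dots\oplus J_{n_l}(\lambda)$, $n_1\ge n_2\ge\dots\ge n_l$, be a complex Jordan canonical matrix with a single eigenvalue $\lambda$, and let $J(\lambda)+\mathcal H$, $\mathcal H=[\mathcal T_{n_i,n_j}]_{i,j=1}^l$, be its Arnold deformation (see context). Let $J(\lambda)^{\#}+\mathcal H^{\#}$ be the parameter matrix obtained from $J(\lambda)+\mathcal H$ by the simultaneous permutation of rows and columns that transforms $J(\lambda)$ into its Weyr canonical form $J(\lambda)^{\#}$ (described in the context). Then $J(\lambda)^{\#}+\mathcal H^{\#}$ is a miniversal deformation of $J(\lambda)^{\#}$, and its matrix $\mathcal H^{\#}$ is lower block triangular (with respect to the partition of $J(\lambda)^{\#}$ described in the context). (ii) Let $J=J(\lambda_1)\oplus\dots\oplus J(\lambda_\tau)$, with $\lambda_i\neq\lambda_j$ for $i\ne j$, be a Jordan canonical matrix in which each $J(\lambda_i)$ is a Jordan matrix with the single eigenvalue $\lambda_i$ and with Jordan blocks in order of non-increasing size, and let $J^{\#}=J(\lambda_1)^{\#}\oplus\dots\oplus J(\lambda_\tau)^{\#}$ be its Weyr canonical form. Let $J+\mathcal K=(J(\lambda_1)+\mathcal H_1)\oplus\dots\oplus(J(\lambda_\tau)+\mathcal H_\tau)$ be the Arnold deformation of $J$, and apply the permutation of (i) to each direct summand. Then the resulting matrix $$J^{\#}+\mathcal K^{\#}:=(J(\lambda_1)^{\#}+\mathcal H_1^{\#})\oplus\dots\oplus(J(\lambda_\tau)^{\#}+\mathcal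 H_\tau^{\#})$$ is a miniversal deformation of $J^{\#}$, which is simple and block triangular.
   Context: All matrices are complex. Deformations. A deformation of an $n\times n$ matrix $A$ is a matrix function $\mathcal A(\alpha_1,\dots,\alpha_k)$ of parameters $\alpha_1,\dots,\alpha_k$, defined on a neighborhood of $\vec 0\in\mathbb C^k$, holomorphic at $\vec 0$, and equal to $A$ at $\vec 0$; two deformations are identified if they coincide on a neighborhood of $\vec 0$. It is versal if all matrices $A+E$ in some neighborhood of $A$ reduce to the form $$\mathcal A(h_1(E),\dots,h_k(E))=\mathcal S(E)^{-1}(A+E)\mathcal S(E),\qquad \mathcal S(0)=I_n,$$ where $\mathcal S(E)$ is a matrix function of the entries of $E$ that is holomorphic at zero. A versal deformation with the minimal number of parameters is called miniversal. A deformation written as $A+\mathcal B(\alpha_1,\dots,\alpha_k)$ is simple if $k$ entries of $\mathcal B$ are the independent parameters $\alpha_1,\dots,\alpha_k$ and all other entries are zero. A simple deformation is block triangular with respect to some partition of $A$ into blocks if $\mathcal B$ is block triangular with respect to the conformal partition and each of its blocks is either $0$ or all of its entries are independent parameters. Jordan blocks. $J_n(\lambda)$ is the $n\times n$ Jordan block with ones above the diagonal. Arnold deformation. For natural numbers $p,q$, $\mathcal T_{pq}$ denotes a $p\times q$ matrix whose entries are zero except for independent parameters (stars) in all positions of the first column if $p<q$, and in all positions of the last row if $p\ge q$. For $J(\lambda)=J_{n_1}(\lambda)\oplus\dots\oplus J_{n_l}(\lambda)$ with $n_1\ge\dots\ge n_l$, $\mathcal H:=[\mathcal T_{n_i,n_j}]_{i,j=1}^l$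 is partitioned conformally to $J(\lambda)$, all stars in all blocks being distinct independent parameters; the Arnold deformation of $J(\lambda)$ is $J(\lambda)+\mathcal H$. For $J=J(\lambda_1)\oplus\dots\oplus J(\lambda_\tau)$ with distinct $\lambda_i$, the Arnold deformation is the direct sum $J+\mathcal K$ of the Arnold deformations $J(\lambda_i)+\mathcal H_i$ (with distinct parameters in different summands). Weyr canonical form. For $J(\lambda)=J_{n_1}(\lambda)\oplus\dots\oplus J_{n_l}(\lambda)$ with $n_1\ge\dots\ge n_l$, permute the first columns of $J_{n_1}(\lambda),\dots,J_{n_l}(\lambda)$ (in this order) into the first $l$ columns, and permute the corresponding rows in the same way. Next permute the second columns of all Jordan blocks of size at least $2\times2$ (in order) into the next columns, and permute the corresponding rows; and so on. The resulting matrix is the Weyr canonical form $J(\lambda)^{\#}$. For $J=J(\lambda_1)\oplus\dots\oplus J(\lambda_\tau)$ with distinct eigenvalues, $J^{\#}:=J(\lambda_1)^{\#}\oplus\dots\oplus J(\lambda_\tau)^{\#}$. Partition. Block triangularity refers to the coarsest partition of $J^{\#}$ (the same for rows and columns) for which all diagonal blocks have the form $\lambda_i I$ and each off-diagonal block is $0$ or $I$. Explicitly, for $J(\lambda)^{\#}$ let $s_i$ be the number of Jordan blocks of $J(\lambda)$ of size at least $i$, and let $k$ be the largest size of a Jordan block; the sizes of the consecutive diagonal blocks form the sequence obtained from $$s_k,\ s_{k-1}-s_k,\dots,s_2-s_3,\ s_1-s_2;\quad s_k,\ s_{k-1}-s_k,\dots,s_2-s_3;\quad\dots;\quad s_k,\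 s_{k-1}-s_k;\quad s_k$$ by removing the zero members. For several eigenvalues the partitions of the direct summands are concatenated. *)

(* Defs.v *)
From HB Require Import structures.
From mathcomp Require Import all_boot all_order all_algebra all_fingroup.
From mathcomp Require Import complex.
From mathcomp Require Import all_classical all_reals topology normedtype derive.

Set Implicit Arguments.
Unset Strict Implicit.
Unset Printing Implicit Defensive.

Import Order.TTheory GRing.Theory Num.Theory.
Import numFieldNormedType.Exports.

Local Open Scope ring_scope.
Local Open Scope classical_set_scope.

(* R[i] seen as a numClosedFieldType, which is what carries the topology and
   the normed-space structure of the complex numbers. *)
Definition cplx (R : realType) : numClosedFieldType := R[i]%C.

Definition holomorphic_at (K : numFieldType) (V W : normedModType K)
    (f : V -> W) (x : V) : Prop :=
  \forall y \near x, differentiable f y.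

(** * Deformations *)

(* A parameter matrix is a total function of the parameter row; only its germ
   at 0 is meaningful. *)
Definition deformation (R : realType) (n k : nat) (A : 'M[cplx R]_n)
    (F : 'rV[cplx R]_k -> 'M[cplx R]_n) : Prop :=
  holomorphic_at F 0 /\ F 0 = A.

(* The parameters h(E) are holomorphic functions of the entries of E, with
   h(0) = 0 so that F (h E) depends on the germ of F only. *)
Definition versal (R : realType) (n k : nat) (A : 'M[cplx R]_n)
    (F : 'rV[cplx R]_k -> 'M[cplx R]_n) : Prop :=
  deformation A F /\
  exists (h : 'M[cplx R]_n -> 'rV[cplx R]_k) (S : 'M[cplx R]_n -> 'M[cplx R]_n),
    [/\ holomorphic_at h 0, h 0 = 0, holomorphic_at S 0, S 0 = 1%:M &
        \forall E \near (0 : 'M[cplx R]_n),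
          S E \in unitmx /\ F (h E) = invmx (S E) *m (A + E) *m S E].

Definition miniversal (R : realType) (n k : nat) (A : 'M[cplx R]_n)
    (F : 'rV[cplx R]_k -> 'M[cplx R]_n) : Prop :=
  versal A F /\
  forall (k' : nat) (G : 'rV[cplx R]_k' -> 'M[cplx R]_n),
    versal A G -> (k <= k')%N.

(* [pos t] is the position of the entry of F - A that is the parameter t. *)
Definition simple_at (R : realType) (n k : nat) (A : 'M[cplx R]_n)
    (F : 'rV[cplx R]_k -> 'M[cplx R]_n) (pos : 'I_k -> 'I_n * 'I_n) : Prop :=
  injective pos /\
  \forall a \near (0 : 'rV[cplx R]_k),
    (forall t, (F a - A) (pos t).1 (pos t).2 = a 0 t) /\
    (forall i j, (i, j) \notin codom pos -> (F a - A) i j = 0).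

Definition simple_deformation (R : realType) (n k : nat) (A : 'M[cplx R]_n)
    (F : 'rV[cplx R]_k -> 'M[cplx R]_n) : Prop :=
  deformation A F /\ exists pos, simple_at A F pos.

(** * Block triangularity *)

(* A partition of an n x n matrix, the same for rows and columns, is the list
   ps of the sizes of the consecutive diagonal blocks; row (or column) i lies
   in the strip [reshape_index ps i], both counted from 0. *)
Definition lower_block_triangular (T : nmodType) (n : nat) (ps : seq nat)
    (B : 'M[T]_n) : Prop :=
  sumn ps = n /\
  forall i j : 'I_n, (reshape_index ps i < reshape_index ps j)%N -> B i j = 0.

Definition upper_block_triangular (T : nmodType) (n : nat) (ps : seq nat)
    (B : 'M[T]_n) : Prop :=
  lower_block_triangular ps B^T.

Definition block_triangular_deformation (R : realType) (n k : nat)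
    (ps : seq nat) (A : 'M[cplx R]_n) (F : 'rV[cplx R]_k -> 'M[cplx R]_n) :
    Prop :=
  deformation A F /\
  exists pos, [/\ simple_at A F pos,
    (\forall a \near (0 : 'rV[cplx R]_k), lower_block_triangular ps (F a - A))
    \/ (\forall a \near (0 : 'rV[cplx R]_k), upper_block_triangular ps (F a - A)) &
    forall b c : nat,
      let in_block (i j : 'I_n) :=
        reshape_index ps i = b /\ reshape_index ps j = c in
      (forall i j, in_block i j -> (i, j) \notin codom pos) \/
      (forall i j, in_block i j -> (i, j) \in codom pos)].

(** * Jordan matrices and the Arnold deformation *)

Definition jordan_sizes (l : nat) (n : 'I_l -> nat) : Prop :=
  [/\ (0 < l)%N, forall i, (0 < n i)%N &
      forall i j : 'I_l, (i <= j)%N -> (n j <= n i)%N].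

Definition jordan_block (K : pzRingType) (n : nat) (lambda : K) : 'M[K]_n :=
  \matrix_(i, j) (if i == j then lambda else
                  if i.+1 == j :> nat then 1 else 0).

Definition jordan_mx (K : pzRingType) (l : nat) (n : 'I_l -> nat) (lambda : K) :
    'M[K]_(\sum_i n i) :=
  \mxdiag_(i < l) jordan_block (n i) lambda.

(* A boolean matrix records which entries are stars. *)
Definition T_stars (p q : nat) : 'M[bool]_(p, q) :=
  \matrix_(i, j) (if (p < q)%N then j == 0 :> nat else i.+1 == p :> nat).

Definition H_stars (l : nat) (n : 'I_l -> nat) : 'M[bool]_(\sum_i n i) :=
  \mxblock_(i < l, j < l) T_stars (n i) (n j).

Definition star_set (n : nat) (P : 'M[bool]_n) : {set 'I_n * 'I_n} :=
  [set ij | P ij.1 ij.2]%SET.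

(* Each star is an independent parameter of its own, one for each column of
   the parameter row; all other entries are 0. *)
Definition fill_stars (K : pzRingType) (n : nat) (P : 'M[bool]_n)
    (a : 'rV[K]_#|star_set P|) : 'M[K]_n :=
  \sum_t a 0 t *: delta_mx (enum_val t).1 (enum_val t).2.

Definition nb_params (l : nat) (n : 'I_l -> nat) : nat := #|star_set (H_stars n)|.

Definition arnold_H (K : pzRingType) (l : nat) (n : 'I_l -> nat)
    (a : 'rV[K]_(nb_params n)) : 'M[K]_(\sum_i n i) :=
  fill_stars a.

Definition arnold_deformation (K : pzRingType) (l : nat) (n : 'I_l -> nat)
    (lambda : K) (a : 'rV[K]_(nb_params n)) : 'M[K]_(\sum_i n i) :=
  jordan_mx n lambda + arnold_H a.

(** * Weyr canonical form *)

(* The rows (and columns) of J(lambda) in the order in which the Weyr form lists them: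
   for c = 0, 1, ..., the c-th rows of all Jordan blocks of size > c. *)
Definition weyr_seq (l : nat) (n : 'I_l -> nat) : seq 'I_(\sum_i n i) :=
  flatten [seq [seq u <- enum 'I_(\sum_i n i) | tagnat.sig2 u == c :> nat]
          | c <- iota 0 (\sum_i n i)].

Lemma perm_weyr_seq (l : nat) (n : 'I_l -> nat) :
  perm_eq (weyr_seq n) (enum 'I_(\sum_i n i)).
Proof.
apply/allP => u _ /=; apply/eqP.
rewrite count_flatten -map_comp.
have -> : [seq (count_mem u \o (fun c => [seq u <- enum 'I_(\sum_i n i) |
             tagnat.sig2 u == c :> nat])) c | c <- iota 0 (\sum_i n i)] =
          [seq (c == tagnat.sig2 u :> nat : nat) | c <- iota 0 (\sum_i n i)].
  apply: eq_map => c /=; rewrite count_filter.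
  rewrite (eq_count (a2 := [pred v | (v == u) && (c == tagnat.sig2 u)])).
    case: (c == _); last first.
      by rewrite (eq_count (a2 := pred0)) ?count_pred0 // => v /=; rewrite andbF.
    rewrite (eq_count (a2 := pred1 u)) => [|v /=]; last by rewrite andbT.
    by rewrite count_uniq_mem ?enum_uniq // mem_enum.
  by move=> v /=; have [->|//] := eqVneq v u; rewrite /= eq_sym.
have -> s (k : nat) : sumn [seq (c == k : nat) | c <- s] = count_mem k s.
  by elim: s => //= c s ->.
rewrite count_uniq_mem ?iota_uniq // mem_iota /= add0n.
rewrite count_uniq_mem ?enum_uniq // mem_enum /=.
by rewrite (leq_trans (ltn_ord (tagnat.sig2 u))) // (bigD1 (tagnat.sig1 u)) //= leq_addr.
Qed.

Lemma weyr_fun_inj (l : nat) (n : 'I_l -> nat) :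
  injective (fun k : 'I_(\sum_i n i) => nth k (weyr_seq n) k).
Proof.
have sz : size (weyr_seq n) = (\sum_i n i)%N.
  by rewrite (perm_size (perm_weyr_seq n)) size_enum_ord.
move=> j k /eqP; rewrite (set_nth_default k) ?sz // nth_uniq ?sz //.
  by move/eqP/val_inj.
by rewrite (perm_uniq (perm_weyr_seq n)) enum_uniq.
Qed.

Definition weyr_perm (l : nat) (n : 'I_l -> nat) : 'S_(\sum_i n i) :=
  perm (@weyr_fun_inj l n).

Definition to_weyr (K : Type) (l : nat) (n : 'I_l -> nat)
    (M : 'M[K]_(\sum_i n i)) : 'M[K]_(\sum_i n i) :=
  row_perm (weyr_perm n) (col_perm (weyr_perm n) M).

Definition weyr_form (K : pzRingType) (l : nat) (n : 'I_l -> nat) (lambda : K) :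
    'M[K]_(\sum_i n i) :=
  to_weyr (jordan_mx n lambda).

Definition nb_blocks_ge (l : nat) (n : 'I_l -> nat) (t : nat) : nat :=
  #|[set i : 'I_l | (t <= n i)%N]%SET|.

(* The g-th row, 1 <= g <= k, is s_k - s_{k+1}, ..., s_g - s_{g+1}, where
   s_{k+1} = 0. *)
Definition weyr_partition (l : nat) (n : 'I_l -> nat) : seq nat :=
  let k := (\max_i n i)%N in
  let s := nb_blocks_ge n in
  [seq d <- flatten [seq [seq (s t - s t.+1)%N | t <- rev (iota g (k.+1 - g))]
                    | g <- iota 1 k]
  | d != 0%N].

(** * Several eigenvalues *)

Definition weyr_sum (K : pzRingType) (tau : nat) (l : 'I_tau -> nat)
    (n : forall i : 'I_tau, 'I_(l i) -> nat) (lambda : 'I_tau -> K) :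
    'M[K]_(\sum_(i < tau) \sum_(j < l i) n i j) :=
  \mxdiag_(i < tau) weyr_form (n i) (lambda i).

(* The parameter row of the direct sum is the concatenation of the parameter
   rows of the summands, so that distinct summands have distinct parameters. *)
Definition weyr_arnold_sum (K : pzRingType) (tau : nat) (l : 'I_tau -> nat)
    (n : forall i : 'I_tau, 'I_(l i) -> nat) (lambda : 'I_tau -> K)
    (a : 'rV[K]_(\sum_(i < tau) nb_params (n i))) :
    'M[K]_(\sum_(i < tau) \sum_(j < l i) n i j) :=
  \mxdiag_(i < tau) to_weyr (arnold_deformation (lambda i) (submxrow a i)).
Arguments weyr_arnold_sum {K tau l} n lambda a.

Definition weyr_partition_sum (tau : nat) (l : 'I_tau -> nat)
    (n : forall i : 'I_tau, 'I_(l i) -> nat) : seq nat :=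
  flatten [seq weyr_partition (n i) | i <- enum 'I_tau].

(* Main.v *)
Require Import Defs.
From HB Require Import structures.
From mathcomp Require Import all_boot all_order all_algebra all_fingroup.
From mathcomp Require Import complex.
From mathcomp Require Import all_classical all_reals topology normedtype derive.
From mathcomp Require Import interval_inference landau.
From mathcomp Require Import ring zify lra.

Set Implicit Arguments.
Unset Strict Implicit.
Unset Printing Implicit Defensive.

Import Order.TTheory GRing.Theory Num.Theory.
Import numFieldNormedType.Exports.

Local Open Scope ring_scope.

(* Let F be a linear parametrization of a complement of the image of
   X |-> X A - A X in the n x n matrices; then A + F is a miniversal deformation
   of A.

   Versality: split every matrix as W = H(W) + x(W) A - A x(W), where H(W) is in
   the range of F.  The matrix S = 1 + x(W) satisfies S (A + H(W)) = (A + E) S if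
   and only if W = E + E x(W) - x(W) H(W).  For small E this is a fixed point
   equation of a contraction, and its solution W(E) is holomorphic in E.

   Minimality: the projection onto the parameters of F kills the commutators
   with A, so composing it with another versal deformation G(h(E)) gives the
   identity to first order: the identity of C^k factors through the space of
   parameters of G.

   For two Jordan blocks with the same eigenvalue, the image of
   X |-> X J_q - J_p X is cut out by the vanishing of sums along diagonals, and
   the stars of T_pq pick one entry of each of these diagonals; for distinct
   eigenvalues the map is bijective.  Complements pass to direct sums and are
   preserved by simultaneous permutations.

   Give row c of a Jordan block of size m the key (c, m).  The Weyr permutation
   sorts the rows by increasing c, then decreasing m, the strips of the partition
   are the level sets of the key, and the keys of its row and of its column tell
   whether an entry is a star. *)

(** * Complements of the image of X |-> X B - A X *)

Section Sylvester.
Variable K : fieldType.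

Definition sylvester p q (A : 'M[K]_p) (B : 'M[K]_q) (X : 'M[K]_(p, q)) :
  'M[K]_(p, q) := X *m B - A *m X.

Definition supported_on p q (P : 'M[bool]_(p, q)) (M : 'M[K]_(p, q)) :=
  forall i j, ~~ P i j -> M i j = 0.

(** The matrices supported on [P] form a complement of the image of [sylvester A B]: the sum is the
    whole space, the intersection is zero. *)
Definition transversal p q (A : 'M[K]_p) (B : 'M[K]_q) (P : 'M[bool]_(p, q)) :=
  (forall E, exists X, supported_on P (E - sylvester A B X)) /\
  (forall X, supported_on P (sylvester A B X) -> sylvester A B X = 0).

Lemma sylvester_is_linear p q (A : 'M[K]_p) (B : 'M[K]_q) :
  linear (sylvester A B).
Proof.
move=> c X Y; rewrite /sylvester mulmxDl mulmxDr -scalemxAl -scalemxAr.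
by rewrite scalerBr opprD addrACA.
Qed.

HB.instance Definition _ p q A B :=
  GRing.isLinear.Build K 'M[K]_(p, q) 'M[K]_(p, q) _ (sylvester A B)
    (sylvester_is_linear A B).

(** This is where finite dimension enters. The inverse is returned as a linear map because the
    differential in [quad_solution] is built from it. *)
Lemma linear_inj_bij (V : vectType K) (f : {linear V -> V}) :
  (forall x, f x = 0 -> x = 0) ->
  exists g : {linear V -> V}, cancel f g /\ cancel g f.
Proof.
move=> f_inj; have kf : lker (linfun f) == 0%VS.
  by apply/lker0P => x y; rewrite !lfunE => /= fxy; apply/subr0_eq/f_inj;
     rewrite linearB fxy subrr.
exists (linfun f)^-1%VF; split=> x.
  by have := lker0_lfunK kf x; rewrite lfunE.
by have := lker0_lfunVK kf x; rewrite lfunE.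
Qed.

(** The value 0 outside the matrix lets inductions on natural number indices run past the last
    row. *)
Definition entry p q (M : 'M[K]_(p, q)) (a b : nat) : K :=
  if insub a is Some i then if insub b is Some j then M i j else 0 else 0.

Lemma entryE p q (M : 'M[K]_(p, q)) (i : 'I_p) (j : 'I_q) : entry M i j = M i j.
Proof. by rewrite /entry !valK. Qed.

Lemma entry_ord p q (M : 'M[K]_(p, q)) a b (ap : (a < p)%N) (bq : (b < q)%N) :
  entry M a b = M (Ordinal ap) (Ordinal bq).
Proof. by rewrite -entryE. Qed.

Lemma entry_row p q (M : 'M[K]_(p, q)) a b : (p <= a)%N -> entry M a b = 0.
Proof. by move=> pa; rewrite /entry insubF // ltnNge pa. Qed.

Lemma entry_col p q (M : 'M[K]_(p, q)) a b : (q <= b)%N -> entry M a b = 0.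
Proof.
by move=> qb; rewrite /entry; case: insubP => // i _ _; rewrite insubF // ltnNge qb.
Qed.

(** The superdiagonal of the right factor shifts the columns of [X], that of the left factor shifts
    its rows; column 0 has no left neighbour, hence the match on [j]. *)
Lemma sylvester_jordanE p q (lambda mu : K) (X : 'M[K]_(p, q)) i j :
  sylvester (jordan_block p lambda) (jordan_block q mu) X i j =
  (mu - lambda) * X i j + (if (j : nat) is b.+1 then entry X i b else 0)
  - entry X i.+1 j.
Proof.
rewrite /sylvester !mxE mulrBl; have -> : \sum_k X i k * jordan_block q mu k j =
   mu * X i j + (if (j : nat) is b.+1 then entry X i b else 0).
  rewrite (bigD1 j) //= !mxE eqxx mulrC; congr (_ + _).
  case: j => -[|b] jq /=.
    by apply: big1 => k kj; rewrite mxE (negPf kj) mulr0.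
  have bq := ltnW jq; rewrite (bigD1 (Ordinal bq)) /=; last first.
    by rewrite -val_eqE /= ltn_eqF.
  rewrite mxE -val_eqE /= ltn_eqF // eqxx mulr1 big1 ?addr0.
    by rewrite -[b]/(val (Ordinal bq)) entryE.
  move=> k /andP[kj kb]; rewrite mxE (negPf kj).
  by rewrite eqSS -[b]/(val (Ordinal bq)) val_eqE (negPf kb) mulr0.
have -> : \sum_k jordan_block p lambda i k * X k j =
   lambda * X i j + entry X i.+1 j.
  rewrite (bigD1 i) //= !mxE eqxx; congr (_ + _).
  case: (ltnP i.+1 p) => [ip|pi]; last first.
    rewrite entry_row // big1 // => k ki; rewrite mxE eq_sym (negPf ki).
    by rewrite gtn_eqF ?mul0r // (leq_trans (ltn_ord k)).
  rewrite (bigD1 (Ordinal ip)) /=; last by rewrite -val_eqE /= gtn_eqF.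
  rewrite mxE -val_eqE /= ltn_eqF // eqxx mul1r big1 ?addr0.
    by rewrite -[i.+1]/(val (Ordinal ip)) entryE.
  move=> k /andP[ki kb]; rewrite mxE eq_sym (negPf ki) eq_sym.
  by rewrite -[i.+1]/(val (Ordinal ip)) val_eqE (negPf kb) mul0r.
by rewrite opprD; ring.
Qed.

(** Entry (a, b) of the equation expresses (mu - lambda) X a b through the entries to its left and
    below it. The induction therefore starts at the lower left corner, and b + (p - a) measures the
    distance from there. *)
Lemma sylvester_jordan_inj p q (lambda mu : K) (X : 'M[K]_(p, q)) :
  lambda != mu ->
  sylvester (jordan_block p lambda) (jordan_block q mu) X = 0 -> X = 0.
Proof.
move=> neq_lm X0.
suff H m a b : (b + (p - a) <= m)%N -> entry X a b = 0.
  by apply/matrixP => i j; rewrite -entryE mxE; exact: H (leqnn _).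
elim: m a b => [|m IHm] a b le_m.
  by apply: entry_row; rewrite -subn_eq0 -leqn0 (leq_trans _ le_m) // leq_addl.
case: (ltnP a p) => [ap|/entry_row //]; case: (ltnP b q) => [bq|/entry_col //].
have /matrixP/(_ (Ordinal ap) (Ordinal bq)) := X0.
rewrite sylvester_jordanE mxE -[X _ _]entryE /=.
have -> : entry X a.+1 b = 0.
  by apply: IHm; rewrite -ltnS (leq_trans _ le_m) // -addnS -subSn.
have -> : (if b is b'.+1 then entry X a b' else 0) = 0.
  by case: b {bq} le_m => // b le_m; apply: IHm.
rewrite addr0 subr0 => /eqP; rewrite mulf_eq0 subr_eq0 eq_sym (negPf neq_lm).
by move/eqP.
Qed.

Lemma transversal_jordan_neq p q (lambda mu : K) : lambda != mu ->
  transversal (jordan_block p lambda) (jordan_block q mu) (const_mx false).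
Proof.
move=> /sylvester_jordan_inj inj_s.
have [g [_ gK]] := linear_inj_bij (inj_s p q).
split=> [E|X sX]; last by apply/matrixP => i j; rewrite [RHS]mxE sX // mxE.
by exists (g E) => i j _; rewrite gK subrr mxE.
Qed.

(* For q <= p, the sum over the diagonal ending at (p - 1, b) vanishes on the
   image of the operator; the partial sums provide preimages. *)
Fixpoint diag_sum (e : nat -> nat -> K) (a b : nat) : K :=
  e a b + match a, b with a'.+1, b'.+1 => diag_sum e a' b' | _, _ => 0 end.

Lemma transversal_jordan_last_row p q (lambda : K) : (q <= p)%N ->
  transversal (jordan_block p lambda) (jordan_block q lambda)
    (\matrix_(i, j) (i.+1 == p :> nat)).
Proof.
move=> le_qp; split=> [E|X sX].
  (* Row 0 is zero and row a + 1 stores the sums along the diagonals that end in row a. Neighbours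
     on a diagonal then differ by an entry of [E], which matches [E] in every row but the last. *)
  exists (- \matrix_(i, j) if (i : nat) is a.+1 then diag_sum (entry E) a j else 0).
  move=> i j; rewrite mxE => ip; rewrite linearN opprK mxE sylvester_jordanE.
  have {}ip : (i.+1 < p)%N by rewrite ltn_neqAle ip ltn_ord.
  rewrite -[i.+1]/(val (Ordinal ip)) entryE !mxE /= subrr mul0r add0r.
  case: i j ip => -[|a] ap [[|b] bq] /= ip; rewrite -entryE /= ?addr0 ?add0r ?subrr //.
    by rewrite (entry_ord _ ap (ltnW bq)) mxE /= add0r subrr.
  by rewrite (entry_ord _ ap (ltnW bq)) mxE /=; ring.
set M := sylvester _ _ X in sX *.
(* Along a diagonal that starts in column 0 the image telescopes. A diagonal ending in the last row
   is of this kind since q <= p, and its sum is 0 because [X] has no row p. By [Z] its part above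
   the last row also sums to 0, so the entry in the last row vanishes. *)
have D a b : (b <= a)%N -> (a < p)%N -> (b < q)%N ->
    diag_sum (entry M) a b = - entry X a.+1 b.
  elim: a b => [|a IHa] [|b] ba ap bq //=;
    rewrite [entry M _ _](entry_ord _ ap bq) sylvester_jordanE /=
            subrr mul0r !add0r ?addr0 //.
  by rewrite IHa ?(ltnW ap) ?(ltnW bq) // addrAC subrr add0r.
have Z a b : (a.+1 < p)%N -> diag_sum (entry M) a b = 0.
  elim: a b => [|a IHa] b ap /=; rewrite /entry; case: insubP => [i _ ia|];
    rewrite -?leqNgt ?addr0 //; try by rewrite leqNgt ltnW.
    case: insubP => [j _ _|//]; rewrite ?addr0; apply: sX; rewrite mxE ia.
    by rewrite ltn_eqF.
  by case: b => [|b]; rewrite ?addr0; case: insubP => [j _ _|]; rewrite ?IHa ?addr0 // 1?ltnW //;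
    apply: sX; rewrite mxE ia ltn_eqF.
apply/matrixP => i j; rewrite [RHS]mxE.
have [/eqP ip|ip] := boolP (i.+1 == p :> nat); last by rewrite sX // mxE.
have ji : (j <= i)%N by rewrite -ltnS ip (leq_trans (ltn_ord j)).
have := D i j ji (ltn_ord i) (ltn_ord j); rewrite entry_row ?ip // oppr0.
have {}Z a b : a.+1 = i -> diag_sum (entry M) a b = 0 by move=> ai; apply: Z; rewrite ai.
rewrite -entryE; case: (nat_of_ord i) Z => [|a] Z /=; rewrite ?addr0 //.
by case: (nat_of_ord j) => [|b]; rewrite ?Z ?addr0.
Qed.

(* Reflection in the antidiagonal fixes Jordan blocks and exchanges first columns
   and last rows. *)
Definition anti_tr (T : Type) p q (M : 'M[T]_(p, q)) : 'M[T]_(q, p) :=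
  \matrix_(i, j) M (rev_ord j) (rev_ord i).

(** [anti_tr] is an involution that reverses products, so it exchanges the two terms of the
    Sylvester operator, which changes the sign. *)
Lemma transversal_anti_tr p q (A : 'M[K]_p) (B : 'M[K]_q) (P : 'M[bool]_(p, q)) :
  transversal A B P ->
  transversal (anti_tr B) (anti_tr A) (anti_tr P).
Proof.
have rvK m n (M : 'M[K]_(m, n)) : anti_tr (anti_tr M) = M.
  by apply/matrixP => i j; rewrite !mxE !rev_ordK.
have rvM m n r (M : 'M[K]_(m, n)) (N : 'M[K]_(n, r)) :
    anti_tr (M *m N) = anti_tr N *m anti_tr M.
  apply/matrixP => i j; rewrite !mxE (reindex_inj rev_ord_inj) /=.
  by apply: eq_bigr => k _; rewrite !mxE mulrC.
have rvS X : sylvester (anti_tr B) (anti_tr A) (anti_tr X) =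
    - anti_tr (sylvester A B X).
  rewrite /sylvester -!rvM; apply/matrixP => i j; rewrite !mxE; ring.
move=> [spanAB dirAB]; split=> [E|X sX].
  have [X sX] := spanAB (anti_tr E); exists (- anti_tr X) => i j; rewrite mxE => Pij.
  by have := sX _ _ Pij; rewrite linearN /= opprK rvS !mxE !rev_ordK.
have := dirAB (anti_tr X); rewrite -[X]rvK rvS rvK in sX *.
move=> -> => [|i j Pij]; first by apply/matrixP => i j; rewrite !mxE oppr0.
have := sX (rev_ord j) (rev_ord i); rewrite !mxE !rev_ordK => /(_ Pij)/eqP.
by rewrite oppr_eq0 => /eqP.
Qed.

Lemma anti_tr_jordan_block n (lambda : K) :
  anti_tr (jordan_block n lambda) = jordan_block n lambda.
Proof.
apply/matrixP => i j; rewrite !mxE (inj_eq rev_ord_inj) eq_sym.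
case: eqP => // _; congr (if _ then _ else _); apply/eqP/eqP => /=.
all: by have := ltn_ord i; have := ltn_ord j; lia.
Qed.

Lemma transversal_jordan_eq p q (lambda : K) :
  transversal (jordan_block p lambda) (jordan_block q lambda) (T_stars p q).
Proof.
have [pq|qp] := ltnP p q; last first.
  have := transversal_jordan_last_row lambda qp; congr (transversal _ _ _).
  by apply/matrixP => i j; rewrite !mxE ltnNge qp.
have := transversal_anti_tr (transversal_jordan_last_row lambda (ltnW pq)).
rewrite !anti_tr_jordan_block; congr (transversal _ _ _).
apply/matrixP => i j; rewrite !mxE pq /=.
by apply/eqP/eqP; have := ltn_ord j; lia.
Qed.

(** For block diagonal matrices the operator acts on each block of [X] separately, so both halves of
    [transversal] can be checked block by block. *)
Lemma transversal_mxdiag l m (p : 'I_l -> nat) (q : 'I_m -> nat)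
    (A : forall i, 'M[K]_(p i)) (B : forall j, 'M[K]_(q j))
    (P : forall i j, 'M[bool]_(p i, q j)) :
  (forall i j, transversal (A i) (B j) (P i j)) ->
  transversal (\mxdiag_i A i) (\mxdiag_j B j) (\mxblock_(i, j) P i j).
Proof.
move=> tr; have sylE X : sylvester (\mxdiag_i A i) (\mxdiag_j B j) X =
    \mxblock_(i, j) sylvester (A i) (B j) (submxblock X i j).
  rewrite -{1}[X]submxblockK /sylvester.
  by rewrite mul_mxblock_mxdiag mul_mxdiag_mxblock mxblockB.
split=> [E|X].
  have X i j := cid ((tr i j).1 (submxblock E i j)).
  exists (\mxblock_(i, j) sval (X i j)); rewrite sylE => s t.
  rewrite !mxE mxblockK; case: (X _ _) => /= Y sY /sY.
  by rewrite !mxE !tagnat.sig2K.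
rewrite sylE => sX; rewrite -[RHS]mxblock0; apply: eq_mxblock => i j.
apply: (tr i j).2 => s t Pst.
have := sX (tagnat.Rank i s) (tagnat.Rank j t).
have blockE (T : Type) (M : forall i j, 'M[T]_(p i, q j)) :
    (\mxblock_(i, j) M i j) (tagnat.Rank i s) (tagnat.Rank j t) = M i j s t.
  by have /matrixP/(_ s t) := mxblockK M i j; rewrite mxE.
by rewrite !blockE; apply.
Qed.

(** The operator commutes with permuting the rows of [X] by [s] and its columns by [t]. *)
Lemma transversal_perm p q (A : 'M[K]_p) (B : 'M[K]_q) (P : 'M[bool]_(p, q))
    (s : 'S_p) (t : 'S_q) :
  transversal A B P ->
  transversal (row_perm s (col_perm s A)) (row_perm t (col_perm t B))
    (row_perm s (col_perm t P)).
Proof.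
have sylE X : sylvester (row_perm s (col_perm s A)) (row_perm t (col_perm t B))
    (row_perm s (col_perm t X)) = row_perm s (col_perm t (sylvester A B X)).
  apply/matrixP => i j; rewrite !mxE; congr (_ - _).
    by rewrite [RHS](reindex_perm t); apply: eq_bigr => k _; rewrite !mxE.
  by rewrite [RHS](reindex_perm s); apply: eq_bigr => k _; rewrite !mxE.
have mxpermK X : row_perm s (col_perm t (row_perm s^-1 (col_perm t^-1 X))) = X.
  by apply/matrixP => i j; rewrite !mxE !permK.
move=> [spanAB dirAB]; split=> [E|X].
  have [X sX] := spanAB (row_perm s^-1 (col_perm t^-1 E)).
  exists (row_perm s (col_perm t X)); rewrite sylE => i j; rewrite !mxE => /sX.
  by rewrite !mxE !permK.
rewrite -[X]mxpermK sylE => sX; rewrite dirAB.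
  by apply/matrixP => i j; rewrite !mxE.
move=> i j Pij; have := sX ((s^-1)%g i) ((t^-1)%g j).
by rewrite !mxE !permKV; apply.
Qed.

End Sylvester.

(** * Norms and differentials of complex matrices *)

Section RealNorm.
Variable R : realType.
Local Notation C := (cplx R).
Local Notation "x %:C" := (real_complex R x : cplx R).

(* The norm of a normed module over C lies in C. *)
Definition rnorm (V : normedModType C) (x : V) : R := complex.Re `|x|.

Lemma rnormE (V : normedModType C) (x : V) : (rnorm x)%:C = `|x|.
Proof. by apply: RRe_real; rewrite normr_real. Qed.

Lemma le_rnorm (V W : normedModType C) (x : V) (y : W) :
  (rnorm x <= rnorm y) = (`|x| <= `|y|).
Proof. by rewrite -!rnormE lecR. Qed.

Lemma rnorm_ge0 (V : normedModType C) (x : V) : 0 <= rnorm x.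
Proof. by rewrite -lecR rnormE normr_ge0. Qed.

Lemma rnormD (V : normedModType C) (x y : V) : rnorm (x + y) <= rnorm x + rnorm y.
Proof. by rewrite -lecR rmorphD /= !rnormE ler_normD. Qed.

Lemma rnormN (V : normedModType C) (x : V) : rnorm (- x) = rnorm x.
Proof. by rewrite /rnorm normrN. Qed.

Lemma rnormB (V : normedModType C) (x y : V) : rnorm (x - y) <= rnorm x + rnorm y.
Proof. by rewrite -[rnorm y]rnormN rnormD. Qed.

Lemma rnormZ (V : normedModType C) (a : C) (x : V) :
  rnorm (a *: x) = rnorm (a : C^o) * rnorm x.
Proof. by apply: complexI; rewrite rmorphM /= !rnormE normrZ. Qed.

Lemma rnorm0 (V : normedModType C) : rnorm (0 : V) = 0.
Proof. by rewrite /rnorm normr0. Qed.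

Lemma rnorm_le0 (V : normedModType C) (x : V) : rnorm x <= 0 -> x = 0.
Proof. by rewrite -lecR rnormE normr_le0 => /eqP. Qed.

Lemma rnorm_sum (V : normedModType C) (I : finType) (f : I -> V) :
  rnorm (\sum_i f i) <= \sum_i rnorm (f i).
Proof.
elim/big_ind2: _ => [|x a y b xa yb|//]; first by rewrite rnorm0.
by rewrite (le_trans (rnormD _ _)) // lerD.
Qed.

(** Neighbourhoods of 0 get a real radius, so that the estimates can be carried out in [R]. *)
Lemma near0_rnormP (V : normedModType C) (P : V -> Prop) :
  (\forall x \near 0, P x) <->
  exists2 e : R, 0 < e & forall x, rnorm x < e -> P x.
Proof.
split=> [/nbhs_norm0P [e /= e_gt0 sub]|[e e_gt0 sub]].
  have eR : (complex.Re e)%:C = e by apply: RRe_real; rewrite gtr0_real.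
  exists (complex.Re e) => [|x]; first by rewrite -ltcR eR.
  by rewrite -ltcR eR rnormE => /sub.
apply/nbhs_norm0P; exists e%:C => /=; first by rewrite ltcR.
by move=> x /=; rewrite -rnormE ltcR => /sub.
Qed.

Lemma continuous_lipschitz (V W : normedModType C) (f : {linear V -> W}) (c : R) :
  (forall x, rnorm (f x) <= c * rnorm x) -> continuous f.
Proof.
move=> fc; apply: bounded_linear_continuous; apply/linear_boundedP.
near=> r => x; apply: (@le_trans _ _ (c%:C * `|x|)).
  by rewrite -!rnormE -rmorphM lecR.
by rewrite ler_wpM2r //; near: r; apply: nbhs_pinfty_ge; apply/complex_realP; exists c.
Unshelve. all: by end_near. Qed.

Lemma lipschitz_continuous (V W : normedModType C) (f : {linear V -> W}) :
  continuous f -> exists2 c : R, 0 <= c & forall x, rnorm (f x) <= c * rnorm x.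
Proof.
move=> /linear_lipschitz [k k_gt0 fk]; exists (complex.Re k).
  by rewrite -lecR RRe_real ?gtr0_real ?ltW.
by move=> x; rewrite -lecR rmorphM /= !rnormE RRe_real ?gtr0_real.
Qed.

(** A remainder bounded by a multiple of |e|^2 is o(e). *)
Lemma is_diff_quadratic (V W : normedModType C) (f : V -> W) (x : V)
    (df : {linear V -> W}) (c : R) : continuous df ->
  (\forall e \near 0, rnorm (f (x + e) - f x - df e) <= c * rnorm e ^+ 2) ->
  is_diff x f df.
Proof.
move=> df_cont /near0_rnormP [d d_gt0 fd].
have fo : f \o shift x = cst (f x) + df +o_ 0 id.
  apply/eqaddoP => eps eps_pos; apply/near0_rnormP.
  have epsR : (complex.Re eps)%:C = eps by apply: RRe_real; rewrite gtr0_real.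
  have eps_gt0 : 0 < complex.Re eps by rewrite -ltcR epsR.
  (* The denominator |c| + 1 is positive whatever the sign of c. *)
  exists (Num.min d (complex.Re eps / (`|c| + 1))).
    by rewrite lt_min d_gt0 divr_gt0 // ltr_wpDl.
  move=> e; rewrite lt_min => /andP[ed ec].
  rewrite -epsR -!rnormE -rmorphM lecR /=.
  rewrite [X in rnorm X](_ : _ = f (x + e) - f x - df e); last first.
    rewrite -[LHS]/(f (e + x) - (f x + df e)).
    by rewrite [e + x]addrC opprD addrA.
  apply: le_trans (fd _ ed) _; rewrite expr2 mulrA ler_wpM2r ?rnorm_ge0 //.
  rewrite ltr_pdivlMr in ec; last by rewrite ltr_wpDl.
  apply: le_trans (ltW ec); rewrite mulrC ler_wpM2l ?rnorm_ge0 //.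
  by rewrite (le_trans (ler_norm _)) // lerDl.
apply: DiffDef; last exact: diff_unique.
by apply/diff_locallyP; rewrite (diff_unique df_cont fo).
Qed.

End RealNorm.

(** * Estimates and fixed points for the maximum norm of matrices *)

Section MatrixNorm.
Variable R : realType.
Local Notation C := (cplx R).
Local Notation "x %:C" := (real_complex R x : cplx R).

(** The norm of a matrix is the maximum over its entries; for an empty matrix it is 0, which is why
    c must be nonnegative. *)
Lemma rnorm_mx_leP m n (M : 'M[C]_(m, n)) (c : R) : 0 <= c ->
  rnorm M <= c <-> forall i j, rnorm (M i j : C^o) <= c.
Proof.
move=> c_ge0; rewrite -lecR rnormE [X in X <= _]/Num.norm /= mx_normE.
have cC : 0 <= c%:C by rewrite lecR.
rewrite -[c%:C]/((NngNum cC)%:num) num_le; split.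
  move=> /bigmax_leP[_ Mc] i j; have := Mc (i, j) isT.
  by rewrite -num_le /= -rnormE lecR.
move=> Mc; apply/bigmax_leP; split=> [|[i j] _]; rewrite -num_le //=.
by rewrite -(rnormE (M i j : C^o)) lecR.
Qed.

Lemma rnorm_leD m n (M N : 'M[C]_(m, n)) a b :
  rnorm M <= a -> rnorm N <= b -> rnorm (M + N) <= a + b.
Proof. by move=> Ma Nb; apply: le_trans (rnormD _ _) (lerD Ma Nb). Qed.

Lemma rnorm_leB m n (M N : 'M[C]_(m, n)) a b :
  rnorm M <= a -> rnorm N <= b -> rnorm (M - N) <= a + b.
Proof. by move=> Ma Nb; apply: le_trans (rnormB _ _) (lerD Ma Nb). Qed.

Lemma rnorm_entry m n (M : 'M[C]_(m, n)) i j : rnorm (M i j : C^o) <= rnorm M.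
Proof. by move: i j; apply/rnorm_mx_leP; rewrite ?rnorm_ge0. Qed.

(** The maximum norm is submultiplicative only up to the inner dimension; the factors n in later
    constants come from here. *)
Lemma rnorm_mulmx m n p (M : 'M[C]_(m, n)) (N : 'M[C]_(n, p)) :
  rnorm (M *m N) <= n%:R * (rnorm M * rnorm N).
Proof.
apply/rnorm_mx_leP; first by rewrite !mulr_ge0 ?rnorm_ge0.
move=> i j.
rewrite mxE (le_trans (rnorm_sum (fun k => M i k * N k j : C^o))) //.
apply: le_trans (_ : \sum_(k < n) rnorm M * rnorm N <= _).
  apply: ler_sum => k _; rewrite (rnormZ (V := C^o) (M i k)).
  by rewrite ler_pM ?rnorm_ge0 ?rnorm_entry.
by rewrite sumr_const card_ord mulr_natl.
Qed.

Lemma lipschitz_mx m n (V : normedModType C) (f : {linear 'M[C]_(m, n) -> V}) :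
  exists2 c : R, 0 <= c & forall M, rnorm (f M) <= c * rnorm M.
Proof.
exists (\sum_i \sum_j rnorm (f (delta_mx i j))).
  by rewrite !sumr_ge0 // => i _; rewrite sumr_ge0 // => j _; rewrite rnorm_ge0.
move=> M; rewrite {1}[M]matrix_sum_delta linear_sum mulr_suml.
apply: le_trans (rnorm_sum _) (ler_sum _ _) => i _.
rewrite linear_sum mulr_suml; apply: le_trans (rnorm_sum _) (ler_sum _ _) => j _.
by rewrite linearZ rnormZ mulrC ler_wpM2l ?rnorm_ge0 ?rnorm_entry.
Qed.

Lemma continuous_linear_mx m n (V : normedModType C)
  (f : {linear 'M[C]_(m, n) -> V}) : continuous f.
Proof. by have [c _] := lipschitz_mx f; apply: continuous_lipschitz. Qed.

Lemma le0_geometric (x c : R) : (forall k, x <= c / 2 ^+ k) -> x <= 0.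
Proof.
move=> xc; rewrite leNgt; apply/negP => x_gt0.
have [k ck] : exists k : nat, c / x < k%:R.
  by exists (Num.truncn (c / x)).+1; apply: truncnS_gt.
have := xc k; rewrite leNgt => /negP; apply.
rewrite ltr_pdivrMr ?exprn_gt0 // mulrC -ltr_pdivrMr //.
by apply: lt_le_trans ck _; rewrite -natrX ler_nat ltnW // ltn_expl.
Qed.

(** The radius e k = 2 c / 2^k is the tail of the geometric series, so the intervals of centre u k
    and radius e k are nested. The limit is the supremum of their left endpoints. *)
Lemma geometric_cvg_real (u : nat -> R) (c : R) : 0 <= c ->
  (forall k, `|u k.+1 - u k| <= c / 2 ^+ k) ->
  exists l, forall k, `|u k - l| <= 2 * c / 2 ^+ k.
Proof.
move=> c_ge0 uc; pose e k := 2 * c / 2 ^+ k.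
have eS k : e k = e k.+1 + c / 2 ^+ k.
  by rewrite /e exprS; field; rewrite expf_neq0.
have e_ge0 k : 0 <= e k by rewrite /e divr_ge0 ?mulr_ge0 ?exprn_ge0.
have lo_mono k j : u k - e k <= u (k + j)%N - e (k + j)%N.
  elim: j => [|j IHj]; first by rewrite addn0.
  apply: (le_trans IHj); rewrite addnS.
  by have := uc (k + j)%N; rewrite ler_norml (eS (k + j)%N) => /andP[? ?]; lra.
have hi_mono k j : u (k + j)%N + e (k + j)%N <= u k + e k.
  elim: j => [|j IHj]; first by rewrite addn0.
  apply: (le_trans _ IHj); rewrite addnS.
  by have := uc (k + j)%N; rewrite ler_norml (eS (k + j)%N) => /andP[? ?]; lra.
pose A := [set u k - e k | k in [set: nat]]%classic.
have ubA k : ubound A (u k + e k).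
  move=> _ [j _ <-]; apply: le_trans (lo_mono j k) _.
  by rewrite addnC; apply: le_trans (hi_mono k j); have := e_ge0 (k + j)%N; lra.
have supA : has_sup A by split; [exists (u 0%N - e 0%N); exists 0%N | exists (u 0%N + e 0%N)].
exists (sup A) => k; rewrite -/(e k) ler_distlC.
have lo : u k - e k <= sup A by apply: sup_upper_bound => //; exists k.
have hi : sup A <= u k + e k by apply: sup_le_ub => //; case: supA.
by rewrite lo hi.
Qed.

(** The constant doubles because |z| <= |Re z| + |Im z| and both parts converge separately. *)
Lemma geometric_cvg_complex (u : nat -> C) (c : R) : 0 <= c ->
  (forall k, rnorm (u k.+1 - u k : C^o) <= c / 2 ^+ k) ->
  exists l, forall k, rnorm (u k - l : C^o) <= 4 * c / 2 ^+ k.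
Proof.
move=> c_ge0 uc.
have [a ha] : exists a, forall k, `|complex.Re (u k) - a| <= 2 * c / 2 ^+ k.
  apply: geometric_cvg_real => // k; rewrite -raddfB.
  by apply: le_trans (uc k); rewrite -lecR rnormE normc_ge_Re.
have normc_ge_Im (x : R[i]) : `|complex.Im x|%:C <= `|x|.
  by rewrite normc_def lecR -sqrtr_sqr ler_wsqrtr // lerDr sqr_ge0.
have [b hb] : exists b, forall k, `|complex.Im (u k) - b| <= 2 * c / 2 ^+ k.
  apply: geometric_cvg_real => // k; rewrite -raddfB.
  by apply: le_trans (uc k); rewrite -lecR rnormE normc_ge_Im.
exists (Complex a b) => k.
have -> : 4 * c / 2 ^+ k = 2 * c / 2 ^+ k + 2 * c / 2 ^+ k by lra.
apply: le_trans (lerD (ha k) (hb k)).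
rewrite -lecR rnormE rmorphD /=; case: (u k) => x y /=.
rewrite [X in `|X|](_ : _ = (x - a)%:C + 'i%C * (y - b)%:C); last first.
  by rewrite [LHS]complexE.
apply: le_trans (ler_normD _ _) _; rewrite normrM.
rewrite normc_def /= [in X in X * _]normc_def normc_def /= !expr0n /= !addr0.
by rewrite add0r expr1n sqrtr1 mul1r !sqrtr_sqr.
Qed.

Lemma geometric_cvg_mx m n (u : nat -> 'M[C]_(m, n)) (c : R) : 0 <= c ->
  (forall k, rnorm (u k.+1 - u k) <= c / 2 ^+ k) ->
  exists L, forall k, rnorm (u k - L) <= 4 * c / 2 ^+ k.
Proof.
move=> c_ge0 uc.
have l i j : {l | forall k, rnorm (u k i j - l : C^o) <= 4 * c / 2 ^+ k}.
  apply: cid; apply: (geometric_cvg_complex c_ge0) => k.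
  by apply: le_trans (uc k); have := rnorm_entry (u k.+1 - u k) i j; rewrite !mxE.
exists (\matrix_(i, j) sval (l i j)) => k.
apply/rnorm_mx_leP; first by rewrite divr_ge0 ?mulr_ge0 ?exprn_ge0.
move=> i j; by rewrite !mxE; case: (l i j) => /= z; apply.
Qed.

(** Banach iteration from 0. With c = |g 0|, the iterates stay within 2 c and the limit within 4 c,
    hence in the ball where g contracts. Comparing g L with g (u k) bounds |g L - L| by 4 c / 2^k
    for every k. *)
Lemma contraction_fixpoint m n (g : 'M[C]_(m, n) -> 'M[C]_(m, n)) (r : R) :
  4 * rnorm (g 0) <= r ->
  (forall W W', rnorm W <= r -> rnorm W' <= r ->
    rnorm (g W - g W') <= rnorm (W - W') / 2) ->
  exists2 W, rnorm W <= 4 * rnorm (g 0) & g W = W.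
Proof.
move=> g0r gK; set c := rnorm (g 0) in g0r *.
have c_ge0 : 0 <= c := rnorm_ge0 _.
pose u k := iter k g 0.
have ur k : rnorm (u k) <= 2 * c.
  elim: k => [|k IHk]; first by rewrite rnorm0 mulr_ge0.
  have := gK (u k) 0; rewrite rnorm0 subr0 => /(_ _ _)/wrap[||H]; [lra|lra|].
  have := rnormD (g (u k) - g 0) (g 0); rewrite subrK -/c -[g (u k)]/(u k.+1).
  by lra.
have uc k : rnorm (u k.+1 - u k) <= c / 2 ^+ k.
  elim: k => [|k IHk]; first by rewrite subr0 divr1.
  have := gK (u k.+1) (u k); move=> /(_ _ _)/wrap[||H].
  - by have := ur k.+1; lra.
  - by have := ur k; lra.
  rewrite exprS invfM mulrCA mulrC; lra.
have [L uL] := geometric_cvg_mx c_ge0 uc.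
have Lc : rnorm L <= 4 * c by have := uL 0%N; rewrite sub0r rnormN divr1.
exists L => //; apply/subr0_eq/rnorm_le0/(le0_geometric (c := 4 * c)) => k.
have H : rnorm (g L - g (u k)) <= rnorm (u k - L) / 2.
  rewrite -(rnormN (u k - L)) opprB; apply: gK; have := ur k; lra.
have := uL k; have := uL k.+1; rewrite exprS invfM mulrCA.
have := rnormD (g L - g (u k)) (u k.+1 - L); rewrite addrA subrK.
lra.
Qed.

End MatrixNorm.

(** * Miniversality *)

(* Before lra, the norms become variables and the context is dropped: comparing
   the atoms up to conversion would unfold the normed structure of matrices. *)
Ltac norm_lra :=
  repeat match goal with
  | |- context [@rnorm ?R ?V ?x] => generalize (@rnorm R V x); intro
  end;
  repeat match goal with H : _ |- _ => clear H end; lra.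


(** * The quadratic fixed point equation and its differentiable solution *)

Section QuadraticEquation.
Variable R : realType.
Local Notation C := (cplx R).

(* See [intertwineP] for the origin of this equation. *)
Definition quad n (x H : {linear 'M[C]_n -> 'M[C]_n}) (E W : 'M[C]_n) : 'M[C]_n :=
  E + E *m x W - x W *m H W.

(** A single constant serves both bilinear terms of [quad]; it is made positive so that a radius can
    be defined by its inverse. *)
Lemma quad_bound n (x H : {linear 'M[C]_n -> 'M[C]_n}) : exists2 M : R, 0 < M &
  forall A W B : 'M[C]_n, rnorm (A *m x W) <= M * (rnorm A * rnorm W) /\
    rnorm (x W *m H B) <= M * (rnorm W * rnorm B).
Proof.
have [cx cx_ge0 xc] := lipschitz_mx x; have [ch ch_ge0 hc] := lipschitz_mx H.
have nn : 0 <= n%:R :> R by [].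
exists (1 + n%:R * cx + n%:R * cx * ch); first by rewrite !ltr_wpDr ?mulr_ge0.
move=> A W B; split; apply: le_trans (rnorm_mulmx _ _) _.
  apply: le_trans (_ : n%:R * (rnorm A * (cx * rnorm W)) <= _).
    by rewrite ler_wpM2l // ler_wpM2l ?rnorm_ge0.
  rewrite [leLHS](_ : _ = n%:R * cx * (rnorm A * rnorm W)); last by ring.
  by rewrite ler_wpM2r ?mulr_ge0 ?rnorm_ge0 // addrAC lerDr addr_ge0 ?mulr_ge0.
apply: le_trans (_ : n%:R * ((cx * rnorm W) * (ch * rnorm B)) <= _).
  by rewrite ler_wpM2l // ler_pM ?rnorm_ge0.
rewrite [leLHS](_ : _ = n%:R * cx * ch * (rnorm W * rnorm B)); last by ring.
by rewrite ler_wpM2r ?mulr_ge0 ?rnorm_ge0 // lerDr addr_ge0 ?mulr_ge0.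
Qed.

(** The quadratic term is split as B(W, W) - B(W', W') = B(W - W', W) + B(W', W - W'). *)
Lemma quad_sub n (x H : {linear 'M[C]_n -> 'M[C]_n}) (E W W' : 'M[C]_n) :
  quad x H E W - quad x H E W' =
  E *m x (W - W') - x (W - W') *m H W - x W' *m H (W - W').
Proof.
rewrite /quad !linearB /= ?mulmxBl ?mulmxBr.
by apply/matrixP => i j; rewrite !mxE; ring.
Qed.

(** The fixed point exists because [quad x H E] is a contraction with factor 1/2 on a small ball. It
    is differentiable by implicit differentiation: the linearized equation is a small perturbation
    of the identity, hence invertible, and what remains is quadratic in the increment of E. *)
Lemma quad_solution n (x H : {linear 'M[C]_n -> 'M[C]_n}) :
  exists W : 'M[C]_n -> 'M[C]_n, W 0 = 0 /\
  \forall E \near (0 : 'M[C]_n), quad x H E (W E) = W E /\ differentiable W E.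
Proof.
have [M M_gt0 MP] := quad_bound x H.
(* With M r = 1/8 each of the three terms of [quad_sub] is at most |U - U'| / 8. The radius d = r /
   4 for E ensures the condition 4 |g 0| <= r of [contraction_fixpoint], as g 0 = E. *)
pose r : R := (8 * M)^-1.
have r_gt0 : 0 < r by rewrite invr_gt0 mulr_gt0.
have Mr : M * r = 1 / 8 by rewrite /r; field; rewrite gt_eqF.
pose d : R := r / 4.
have d_gt0 : 0 < d by rewrite divr_gt0.
have lip E U U' : rnorm E <= r / 4 -> rnorm U <= r -> rnorm U' <= r ->
    rnorm (quad x H E U - quad x H E U') <= rnorm (U - U') / 2.
  move=> Ed Ur U'r; rewrite quad_sub; set D := U - U'.
  have [h1 _] := MP E D 0; have [_ h2] := MP 0 D U; have [_ h3] := MP 0 U' D.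
  apply: le_trans (rnorm_leB (rnorm_leB h1 h2) h3) _.
  have bound a : 0 <= a -> a <= r -> M * (a * rnorm D) <= rnorm D / 8.
    move=> a_ge0 ar; rewrite mulrA mulrC ler_wpM2l ?rnorm_ge0 //.
    apply: le_trans (ler_wpM2l (ltW M_gt0) ar) _. rewrite Mr. by rewrite div1r.
  have Er : rnorm E <= r by move: Ed r_gt0; norm_lra.
  have := bound _ (rnorm_ge0 _) Er.
  have := bound _ (rnorm_ge0 _) Ur; have := bound _ (rnorm_ge0 _) U'r.
  rewrite [rnorm D * rnorm U]mulrC.
  by have := rnorm_ge0 D; norm_lra.
have quad0 E : quad x H E 0 = E by rewrite /quad !linear0 ?(mulmx0, mul0mx, oppr0, addr0).
(* Outside the ball of radius d the solution gets the default value 0. *)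
have sol E : {W | rnorm E <= d -> rnorm W <= 4 * rnorm E /\ quad x H E W = W}.
  apply: cid; case: (leP (rnorm E) d) => [Ed|_]; last by exists 0.
  have [|W W' Wr W'r|W Wr WE] := contraction_fixpoint (g := quad x H E) (r := r).
  - by rewrite quad0; move: Ed; rewrite /d; norm_lra.
  - by apply: lip.
  - by exists W => _; rewrite quad0 in Wr.
pose W E := sval (sol E).
have WP E : rnorm E <= d -> rnorm (W E) <= 4 * rnorm E /\ quad x H E (W E) = W E.
  by rewrite /W; case: (sol E).
exists W; split.
  have [] := WP 0; rewrite rnorm0 ?(ltW d_gt0) // mulr0 => /rnorm_le0 //.
apply/near0_rnormP; exists d => // E Ed.
have [W0r W0E] := WP E (ltW Ed); split=> //.
set W0 := W E in W0r W0E.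
have {}W0r : rnorm W0 <= r by move: Ed W0r; rewrite /d; norm_lra.
(* [L] is the differential at W0 of W - quad x H E W with respect to W. *)
pose L w : 'M[C]_n := w - (E *m x w - x w *m H W0 - x W0 *m H w).
have L_lin : linear L.
  move=> a u v; rewrite /L !linearP /= mulmxDl -scalemxAl.
  move: (E *m x u) (E *m x v) (x u *m H W0) (x v *m H W0) (x W0 *m H u)
    (x W0 *m H v).
  by do ?move=> ?; apply/matrixP => i j; rewrite !mxE; ring.
pose Llin := GRing.isLinear.Build _ _ _ _ L L_lin.
pose LL : {linear 'M[C]_n -> 'M[C]_n} := HB.pack L Llin.
(* [L] differs from the identity by at most 1/2 in norm, which makes it injective and bounds its
   inverse by 2. *)
have Lw w : rnorm w <= 2 * rnorm (L w).
  suff HwL : rnorm (w - L w) <= rnorm w / 2.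
    have := rnorm_leD (lexx (rnorm (L w))) HwL; rewrite addrC subrK.
    by have := rnorm_ge0 w; norm_lra.
  have [h1 _] := MP E w 0; have [_ h2] := MP 0 w W0; have [_ h3] := MP 0 W0 w.
  rewrite /L opprB addrCA subrr addr0.
  apply: le_trans (rnorm_leB (rnorm_leB h1 h2) h3) _.
  have bound a : 0 <= a -> a <= r -> M * (a * rnorm w) <= rnorm w / 8.
    move=> a_ge0 ar; rewrite mulrA mulrC ler_wpM2l ?rnorm_ge0 //.
    by apply: le_trans (ler_wpM2l (ltW M_gt0) ar) _; rewrite Mr div1r.
  have := bound _ (rnorm_ge0 _) W0r.
  have Er : rnorm E <= r by move: Ed r_gt0; rewrite /d; norm_lra.
  have := bound _ (rnorm_ge0 _) Er.
  rewrite [rnorm w * rnorm W0]mulrC.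
  by have := rnorm_ge0 w; norm_lra.
have L_inj w : LL w = 0 -> w = 0.
  by move=> Lw0; apply: rnorm_le0; have := Lw w; rewrite [L w]Lw0 rnorm0 mulr0.
have [G [LK GK]] := linear_inj_bij L_inj.
(* The derivative of [quad] in E is e + e x(W0), so to first order the increment w of W solves L w =
   e + e x(W0). *)
pose D e := G (e + e *m x W0).
have D_lin : linear D.
  move=> a u v; rewrite /D -linearP; congr (G _).
  by rewrite mulmxDl -scalemxAl scalerDr addrACA.
pose Dlin := GRing.isLinear.Build _ _ _ _ D D_lin.
pose DD : {linear 'M[C]_n -> 'M[C]_n} := HB.pack D Dlin.
suff : is_diff E W DD by case.
(* By |w| <= 4 |e| the remainder is at most 2 (M |e| |w| + M |w|^2) <= 2 (4 + 16) M |e|^2. *)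
apply: (@is_diff_quadratic _ _ _ _ _ _ (40 * M)).
  exact: continuous_linear_mx.
apply/near0_rnormP; exists (d - rnorm E); first by rewrite subr_gt0.
move=> e ed; set W1 := W (E + e); set w := W1 - W0.
have Eed : rnorm (E + e) <= d.
  by apply: le_trans (rnorm_leD (lexx _) (lexx _)) _; move: ed; norm_lra.
have [W1r W1E] := WP _ Eed; rewrite -/W1 in W1r W1E.
have {}W1r : rnorm W1 <= r by move: Eed W1r; rewrite /d; norm_lra.
(* The contraction absorbs |w| / 2, and changing E to E + e at fixed W0 costs at most |e| + |e| /
   8. *)
have we : rnorm w <= 4 * rnorm e.
  have wE : w = (quad x H (E + e) W1 - quad x H (E + e) W0) + (e + e *m x W0).
    suff -> : quad x H (E + e) W0 = quad x H E W0 + (e + e *m x W0).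
      by rewrite W1E W0E opprD [_ + (- _ - _)]addrA subrK.
    rewrite /quad mulmxDl; move: (E *m x W0) (e *m x W0) (x W0 *m H W0).
    by do ?move=> ?; apply/matrixP => i j; rewrite !mxE; ring.
  have [h _] := MP e W0 0; have hM : M * (rnorm e * rnorm W0) <= rnorm e / 8.
    rewrite mulrCA ler_wpM2l ?rnorm_ge0 //.
    by apply: le_trans (ler_wpM2l (ltW M_gt0) W0r) _; rewrite Mr div1r.
  have : rnorm w <= rnorm w / 2 + (rnorm e + M * (rnorm e * rnorm W0)).
    rewrite {1}wE; apply: rnorm_leD; first exact: lip.
    by apply: rnorm_leD.
  by move: hM (rnorm_ge0 e); norm_lra.
(* Exact linearization: only the terms of second order in (e, w) remain besides the linear
   right-hand side. *)
have LwE : L w = (e + e *m x W0) + (e *m x w - x w *m H w).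
  have wE : w = quad x H (E + e) W1 - quad x H E W0 by rewrite W1E W0E.
  have xE : x W1 = x W0 + x w by rewrite -linearD /w addrC subrK.
  have HE : H W1 = H W0 + H w by rewrite -linearD /w addrC subrK.
  rewrite /L {1}wE /quad xE HE !(mulmxDl, mulmxDr).
  move: (E *m x W0) (E *m x w) (e *m x W0) (e *m x w) (x W0 *m H W0)
    (x W0 *m H w) (x w *m H W0) (x w *m H w).
  by do ?move=> ?; apply/matrixP => i j; rewrite !mxE; ring.
have -> : w - DD e = w - G (e + e *m x W0) by [].
apply: le_trans (Lw _) _.
have -> : L (w - G (e + e *m x W0)) = e *m x w - x w *m H w.
  by rewrite -[L _]/(LL _) linearB GK -[LL w]/(L w) LwE addrC addKr.
have [h1 _] := MP e w 0; have [_ h2] := MP 0 w w.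
apply: le_trans (ler_wpM2l _ (rnorm_leB h1 h2)) _ => //.
have : M * (rnorm e * rnorm w) <= M * (4 * rnorm e ^+ 2).
  by rewrite ler_wpM2l ?(ltW M_gt0) // expr2 mulrCA ler_wpM2l ?rnorm_ge0.
have : M * (rnorm w * rnorm w) <= M * (16 * rnorm e ^+ 2).
  rewrite ler_wpM2l ?(ltW M_gt0) //.
  have -> : 16 * rnorm e ^+ 2 = (4 * rnorm e) * (4 * rnorm e) by ring.
  by rewrite ler_pM ?rnorm_ge0.
norm_lra.
Qed.

End QuadraticEquation.

(** * Positions of the parameters and the projection onto them *)

Section Positions.
Variables (K : fieldType) (k n : nat) (pos : 'I_k -> 'I_n * 'I_n).

(** Like [fill_stars], but for an arbitrary enumeration [pos] of the stars: permutations and direct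
    sums move the stars while each keeps its parameter. *)
Definition fill_pos (a : 'rV[K]_k) : 'M[K]_n :=
  \sum_t a 0 t *: delta_mx (pos t).1 (pos t).2.

Definition read_pos (M : 'M[K]_n) : 'rV[K]_k := \row_t M (pos t).1 (pos t).2.

Definition pos_stars : 'M[bool]_n := \matrix_(i, j) ((i, j) \in codom pos).

Lemma fill_pos_is_linear : linear fill_pos.
Proof.
move=> c a b; rewrite /fill_pos scaler_sumr -big_split /=.
by apply: eq_bigr => t _; rewrite !mxE scalerDl scalerA.
Qed.

HB.instance Definition _ :=
  GRing.isLinear.Build K 'rV[K]_k 'M[K]_n _ fill_pos fill_pos_is_linear.

Lemma read_pos_is_linear : linear read_pos.
Proof. by move=> c M N; apply/rowP => t; rewrite !mxE. Qed.

HB.instance Definition _ :=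
  GRing.isLinear.Build K 'M[K]_n 'rV[K]_k _ read_pos read_pos_is_linear.

Lemma fill_posE a : injective pos ->
  forall t, fill_pos a (pos t).1 (pos t).2 = a 0 t.
Proof.
move=> pos_inj t; rewrite /fill_pos summxE (bigD1 t) //= !mxE !eqxx mulr1.
rewrite big1 ?addr0 // => u ut; rewrite !mxE -xpair_eqE -!surjective_pairing.
by rewrite (inj_eq pos_inj) eq_sym (negPf ut) mulr0.
Qed.

Lemma fill_pos_out a i j : (i, j) \notin codom pos -> fill_pos a i j = 0.
Proof.
move=> ij; rewrite /fill_pos summxE big1 // => t _; rewrite !mxE -xpair_eqE.
rewrite -surjective_pairing; case: eqP => [ijt|]; last by rewrite mulr0.
by case/negP: ij; rewrite ijt codom_f.
Qed.

Lemma fill_posK : injective pos -> cancel fill_pos read_pos.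
Proof. by move=> pos_inj a; apply/rowP => t; rewrite mxE fill_posE. Qed.

Lemma supported_fill_pos a : supported_on pos_stars (fill_pos a).
Proof. by move=> i j; rewrite mxE; apply: fill_pos_out. Qed.

Lemma read_posK M : injective pos -> supported_on pos_stars M ->
  fill_pos (read_pos M) = M.
Proof.
move=> pos_inj sM; apply/matrixP => i j.
have [/codomP[t ijt]|ij] := boolP ((i, j) \in codom pos).
  by have := fill_posE (read_pos M) pos_inj t; rewrite -ijt mxE -ijt.
by rewrite fill_pos_out ?sM // mxE.
Qed.

(** Conjugation by 1 + X is written without inverses. For M = H(W) and X = x(W) the left side of the
    second equation is W, and the right side is [quad x H E W]. *)
Lemma intertwineP (A E X M : 'M[K]_n) :
  (1%:M + X) *m (A + M) = (A + E) *m (1%:M + X) <->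
  M + sylvester A A X = E + E *m X - X *m M.
Proof.
rewrite /sylvester [(1%:M + X) *m _]mulmxDl mul1mx [X *m (A + M)]mulmxDr.
rewrite [(A + E) *m (1%:M + X)]mulmxDr mulmx1 [(A + E) *m X]mulmxDl.
move: (X *m A) (A *m X) (E *m X) (X *m M) => P Q U T.
split=> [/(canRL (addrK _)) e|/(canRL (addrK _)) ->].
  have -> : M = A + E + (Q + U) - (P + T) - A by rewrite -e addrC addKr.
  by apply/matrixP => i j; rewrite !mxE; ring.
by apply/matrixP => i j; rewrite !mxE; ring.
Qed.

(** Since the intersection is zero, the parameters in a decomposition are unique ([uniq_h]), so the
    chosen [h] is automatically linear. *)
Lemma transversal_projection (A : 'M[K]_n) :
  injective pos -> transversal A A pos_stars ->
  exists (h : {linear 'M[K]_n -> 'rV[K]_k}) (x : {linear 'M[K]_n -> 'M[K]_n}),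
    [/\ forall E, E = fill_pos (h E) + sylvester A A (x E),
        forall a, h (fill_pos a) = a & forall X, h (sylvester A A X) = 0].
Proof.
move=> pos_inj [span dir].
have uniq_h a b X Y : fill_pos a + sylvester A A X = fill_pos b + sylvester A A Y ->
    a = b.
  move=> eq_ab; have eq_X : sylvester A A (Y - X) = fill_pos (a - b).
    rewrite [LHS]linearB [RHS]linearB /=.
    have -> : sylvester A A Y = fill_pos a + sylvester A A X - fill_pos b.
      by rewrite eq_ab addrC addKr.
    by rewrite addrAC addrK.
  apply/subr0_eq/(can_inj (fill_posK pos_inj)); rewrite linear0 -eq_X.
  by apply: dir; rewrite eq_X; apply: supported_fill_pos.
have dec E : {a | exists X, E = fill_pos a + sylvester A A X}.
  apply: cid; have [X sX] := span E; exists (read_pos (E - sylvester A A X)), X.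
  by rewrite read_posK // subrK.
pose h E := sval (dec E).
have hP E : exists X, E = fill_pos (h E) + sylvester A A X.
  by rewrite /h; case: (dec E).
have h_lin : linear h.
  move=> c E F; have [X EX] := hP E; have [Y FY] := hP F.
  have [Z EFZ] := hP (c *: E + F).
  apply: (uniq_h _ _ Z (c *: X + Y)); rewrite -EFZ {1}EX {1}FY !linearP /=.
  by rewrite scalerDr addrACA.
pose hlin := GRing.isLinear.Build _ _ _ _ h h_lin.
pose hh : {linear 'M[K]_n -> 'rV[K]_k} := HB.pack h hlin.
(* This generalized inverse of the Sylvester operator is a linear section on its image; it is
   applied to the component of E in that image. *)
pose x := (linfun (sylvester A A))^-1%VF.
pose xx : {linear 'M[K]_n -> 'M[K]_n} := x \o (idfun \- (fill_pos \o hh)).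
exists hh, xx; split=> [E|a|X].
- have [X EX] := hP E.
  have -> : sylvester A A (xx E) = E - fill_pos (h E); last by rewrite addrC subrK.
  have := @limg_lfunVK _ _ _ (linfun (sylvester A A)) (E - fill_pos (h E)).
  rewrite lfunE; apply; rewrite {1}EX [_ + _ - _]addrAC subrr add0r.
  by have := memv_img (linfun (sylvester A A)) (memvf X); rewrite lfunE.
- have [X aX] := hP (fill_pos a); apply: (uniq_h _ _ X 0).
  by rewrite -aX linear0 addr0.
- have [Y aY] := hP (sylvester A A X); apply: (uniq_h _ _ Y X).
  by rewrite -aY linear0 add0r.
Qed.

End Positions.

(** * Versality and minimality of the linear parametrization *)

Section Miniversal.
Variable R : realType.
Local Notation C := (cplx R).

Lemma differentiable_lipschitz_near0 (V W : normedModType C) (f : V -> W) :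
  differentiable f 0 -> exists2 c : R, 0 <= c &
    \forall e \near (0 : V), rnorm (f e - f 0) <= c * rnorm e.
Proof.
move=> df; have [c c_ge0 dfc] := lipschitz_continuous (diff_continuous df).
have := diff_locally df => /eqaddoP/(_ _ ltr01) o1.
(* c bounds the differential, and 1 bounds the o(e) remainder. *)
exists (1 + c); first by rewrite addr_ge0.
apply: filterS o1 => e fe.
have {}fe : rnorm (f e - f 0 - 'd f 0 e) <= rnorm e.
  have {fe} : `|f (e + 0) - (f 0 + 'd f 0 e)| <= 1 * `|e| := fe.
  by rewrite addr0 mul1r opprD addrA le_rnorm.
rewrite mulrDl mul1r -[f e - f 0](subrK ('d f 0 e)).
exact: le_trans (rnormD _ _) (lerD fe (dfc e)).
Qed.

Lemma holomorphic_atW (V W : normedModType C) (f : V -> W) (x : V) :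
  (forall y, differentiable f y) -> holomorphic_at f x.
Proof. by move=> df; apply: nearW. Qed.

(** The left kernel k satisfies k = - k X, hence |k| <= |k| / 2. *)
Lemma unitmx_near1 n (X : 'M[C]_n) : n%:R * rnorm X <= 1 / 2 -> 1%:M + X \in unitmx.
Proof.
move=> Xn; rewrite -row_free_unit -kermx_eq0; set k := kermx _.
apply/eqP; have kX : k = - (k *m X).
  by apply/eqP; rewrite -addr_eq0 -{1}[k]mulmx1 -mulmxDr mulmx_ker.
apply: rnorm_le0; have : rnorm k <= rnorm k / 2.
  rewrite {1}kX rnormN (le_trans (rnorm_mulmx _ _)) // mulrCA ler_wpM2l ?rnorm_ge0 //.
  by rewrite -div1r.
by have := rnorm_ge0 k; norm_lra.
Qed.

Lemma deformation_fill_pos n k (A : 'M[C]_n) (pos : 'I_k -> 'I_n * 'I_n) :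
  deformation A (fun a => A + fill_pos pos a).
Proof.
split; last by rewrite linear0 addr0.
apply: holomorphic_atW => a; apply: differentiableD; first exact: differentiable_cst.
exact/linear_differentiable/continuous_linear_mx.
Qed.

Lemma versal_fill_pos n k (A : 'M[C]_n) (pos : 'I_k -> 'I_n * 'I_n) :
  injective pos -> transversal A A (pos_stars pos) ->
  versal A (fun a => A + fill_pos pos a).
Proof.
move=> pos_inj trA; split; first exact: deformation_fill_pos.
have [h [x [hx hfill hsyl]]] := transversal_projection pos_inj trA.
pose H : {linear 'M[C]_n -> 'M[C]_n} := fill_pos pos \o h.
have [W [W0 Wnear]] := quad_solution x H.
have dW : \forall E \near (0 : 'M[C]_n), differentiable W E.
  by apply: filterS Wnear => E [].
exists (fun E => h (W E)), (fun E => 1%:M + x (W E)); split.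
- apply: filterS dW => E dWE; apply: (differentiable_comp dWE).
  exact/linear_differentiable/continuous_linear_mx.
- by rewrite W0 linear0.
- apply: filterS dW => E dWE; apply: differentiableD; first exact: differentiable_cst.
  apply: (differentiable_comp dWE).
  exact/linear_differentiable/continuous_linear_mx.
- by rewrite W0 linear0 addr0.
have [c c_ge0 Wc] := differentiable_lipschitz_near0 (nbhs_singleton dW).
have [cx cx_ge0 xc] := lipschitz_mx x.
have small : \forall E \near (0 : 'M[C]_n), n%:R * rnorm (x (W E)) <= 1 / 2.
  have /near0_rnormP [d d_gt0 dc] := Wc.
  (* On the ball chosen below, n |x(W E)| <= n cx c |E| <= b |E| < 1/2, as [unitmx_near1] requires;
     the summand 1 keeps b positive. *)
  pose b := n%:R * (cx * c) + 1; have b_gt0 : 0 < b by rewrite ltr_wpDl ?mulr_ge0.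
  apply/near0_rnormP; exists (Num.min d (1 / 2 / b)).
    by rewrite lt_min d_gt0 !divr_gt0.
  move=> E; rewrite lt_min => /andP[Ed Eb]; rewrite ltr_pdivlMr // in Eb.
  have /= := dc E Ed; rewrite W0 subr0 => WE.
  apply: le_trans (ltW Eb); rewrite /b mulrDr mulr1.
  apply: le_trans (_ : rnorm E * (n%:R * (cx * c)) <= _); last by rewrite lerDl rnorm_ge0.
  rewrite mulrCA ler_wpM2l // (le_trans (xc _)) // mulrCA ler_wpM2l //.
  by rewrite mulrC.
apply: filterS2 small Wnear => E /unitmx_near1 Su [WE _]; split=> //.
set S := 1%:M + x (W E) in Su *.
suff SA : S *m (A + fill_pos pos (h (W E))) = (A + E) *m S.
  by rewrite -mulmxA -SA mulKmx.
(* By [hx] the left side is W E, so this is the fixed point equation. *)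
have eqW : fill_pos pos (h (W E)) + sylvester A A (x (W E)) =
    E + E *m x (W E) - x (W E) *m fill_pos pos (h (W E)).
  by rewrite -hx -[LHS]WE.
exact/intertwineP.
Qed.

(* If S G(h E) = (A + E) S with S(0) = 1, then modulo commutators with A, which
   the projection onto the parameters kills, G(h E) - A agrees with E to first
   order; so the identity of C^k factors through the k' parameters of G. *)
Lemma versal_parameters n k k' (A : 'M[C]_n) (pos : 'I_k -> 'I_n * 'I_n)
    (G : 'rV[C]_k' -> 'M[C]_n) :
  injective pos -> transversal A A (pos_stars pos) -> versal A G -> (k <= k')%N.
Proof.
move=> pos_inj trA [[dG G0] [h' [S [dh' h'0 dS S0 SG]]]].
have [h [x [hx hfill hsyl]]] := transversal_projection pos_inj trA.
have {}dG := nbhs_singleton dG; have {}dS := nbhs_singleton dS.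
have {}dh' := nbhs_singleton dh'.
pose B : {linear 'rV[C]_k -> 'M[C]_n} := fill_pos pos.
have dB a : differentiable B a by apply/linear_differentiable/continuous_linear_mx.
pose p := h' \o B; have p0 : p 0 = 0 by rewrite /p /= linear0 h'0.
have dp : differentiable p 0.
  by apply: differentiable_comp; [exact: dB | rewrite linear0].
pose q a := h (G a - A); have q0 : q 0 = 0 by rewrite /q G0 subrr linear0.
have dq : differentiable q 0.
  apply: (@differentiable_comp _ _ _ _ (fun a => G a - A)).
    by apply: differentiableB => //; apply: differentiable_cst.
  exact/linear_differentiable/continuous_linear_mx.
have [cs cs_ge0 Sc] := differentiable_lipschitz_near0 dS.
have dGh : differentiable (G \o h') 0 by apply: differentiable_comp; rewrite ?h'0.
have [cg cg_ge0 Gc] := differentiable_lipschitz_near0 dGh.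
have [ch ch_ge0 hc] := lipschitz_mx h; have [cb cb_ge0 bc] := lipschitz_mx B.
have qp_id : is_diff 0 (q \o p) idfun.
  (* With |s| <= cs |E|, |g| <= cg |E| and |E| <= cb |a|, this c |a|^2 bounds |h (E s - s g)|, the
     deviation of q (p a) from a. *)
  pose c := ch * (n%:R * (1 * cs) + n%:R * (cs * cg)) * cb ^+ 2.
  apply: (@is_diff_quadratic _ _ _ _ _ _ c); first by move=> ?; apply: cvg_id.
  have /near0_rnormP [d d_gt0 dP] : \forall E \near (0 : 'M[C]_n),
      [/\ rnorm (S E - 1%:M) <= cs * rnorm E, rnorm (G (h' E) - A) <= cg * rnorm E &
       S E *m G (h' E) = (A + E) *m S E].
    have H : \forall E \near (0 : 'M[C]_n),
       S E *m G (h' E) = (A + E) *m S E.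
      by apply: filterS SG => E [SE ->]; rewrite -mulmxA mulKVmx.
    apply: filterS3 Sc Gc H => E; rewrite S0 /= h'0 G0 => *.
    by split.
  apply/near0_rnormP; exists (d / (cb + 1)); first by rewrite divr_gt0 ?ltr_wpDl.
  move=> a; rewrite ltr_pdivlMr ?ltr_wpDl // => ad.
  have Ed : rnorm (B a) < d.
    apply: le_lt_trans (bc a) (le_lt_trans _ ad).
    by rewrite mulrDr mulr1 mulrC lerDl rnorm_ge0.
  have [] := dP _ Ed; rewrite -[h' (B a)]/(p a) add0r; set E := B a.
  set s := S E - 1%:M; set g := G (p a) - A => sE gE eqSG.
  (* [intertwineP] with X = s and M = g gives g up to a commutator with A; h kills that commutator
     and sends E to a. *)
  have hg : q (p a) - a = h (E *m s - s *m g).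
    rewrite /q -/g -[X in _ - X = _]hfill -[fill_pos pos a]/E.
    have gE' : g = E + (E *m s - s *m g) - sylvester A A s.
      rewrite addrA -(intertwineP A E s g).1 ?addrK //.
      by rewrite addrC subrK addrC subrK.
    rewrite {1}gE' [h (_ - sylvester _ _ _)]linearB hsyl subr0.
    by rewrite [h (E + _)]linearD addrC addKr.
  rewrite [(q \o p) a]/= [(q \o p) 0]/= p0 q0 subr0 hg.
  apply: le_trans (hc _) _.
  rewrite /c -!mulrA ler_wpM2l //.
  apply: le_trans (_ : (n%:R * (1 * cs) + n%:R * (cs * cg)) * rnorm E ^+ 2 <= _).
    rewrite mulrDl; apply: rnorm_leB; apply: le_trans (rnorm_mulmx _ _) _.
      rewrite -!mulrA ler_wpM2l // mul1r expr2 mulrCA ler_wpM2l ?rnorm_ge0 //.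
    rewrite -!mulrA ler_wpM2l //.
    apply: le_trans (ler_pM (rnorm_ge0 _) (rnorm_ge0 _) sE gE) _.
    by rewrite expr2 mulrACA -!mulrA.
  rewrite [X in _ <= _ * X](_ : _ = (cb * rnorm a) ^+ 2); last by ring.
  rewrite ler_wpM2l ?addr_ge0 ?mulr_ge0 // ler_sqr ?bc //.
    by rewrite nnegrE rnorm_ge0.
  by rewrite nnegrE mulr_ge0 ?rnorm_ge0.
have dqp : 'd (q \o p) 0 = 'd q (p 0) \o 'd p 0 :> (_ -> _).
  by apply: diff_comp; rewrite ?p0.
(* The Jacobian matrices, of sizes k x k' and k' x k, multiply to the identity, which forces k <=
   k'. *)
have PQ : lin1_mx ('d p 0) *m lin1_mx ('d q (p 0)) = 1%:M.
  apply/row_matrixP => i; rewrite rowE mulmxA !mul_rV_lin1 row1 /=.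
  rewrite -[RHS]/(idfun (delta_mx 0 i)) -(diff_val (is_diff_def := qp_id)) dqp.
  by [].
exact: mulmx1_min PQ.
Qed.

Theorem miniversal_fill_pos n k (A : 'M[C]_n) (pos : 'I_k -> 'I_n * 'I_n) :
  injective pos -> transversal A A (pos_stars pos) ->
  miniversal A (fun a => A + fill_pos pos a).
Proof.
move=> pos_inj trA; split; first exact: versal_fill_pos.
by move=> k' G; apply: versal_parameters pos_inj trA.
Qed.

End Miniversal.

(** * Weyr partitions *)

Section Strips.

Lemma pairwise_flatten (S T : Type) (rS : rel S) (rT : rel T) (F : S -> seq T) s :
  (forall a, pairwise rT (F a)) ->
  (forall a b, rS a b -> allrel rT (F a) (F b)) ->
  pairwise rS s -> pairwise rT (flatten [seq F a | a <- s]).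
Proof.
move=> FT FS; elim: s => //= a s IHs /andP[a_s s_s].
rewrite pairwise_cat FT IHs // !andbT.
elim: s a_s {IHs s_s} => [|b s IHs] /=; first by rewrite allrel0r.
by case/andP=> ab /IHs; rewrite allrel_catr FS.
Qed.

(** The list of all keys is sorted, so it is a concatenation of constant runs in the order of [ts],
    with lengths the sizes of the level sets. Then [reshape_index ps p] is the number of the run
    that contains p. Dropping the zeros of [ps] drops the keys that no p has. *)
Lemma strips_of_key (T : eqType) (lt : rel T) N (key : 'I_N -> T) (ts : seq T) :
  irreflexive lt -> transitive lt -> pairwise lt ts ->
  (forall p : 'I_N, key p \in ts) ->
  (forall p q : 'I_N, (p < q)%N -> (key p == key q) || lt (key p) (key q)) ->
  let ps := [seq d <- [seq #|[pred p | key p == t]| | t <- ts] | d != 0%N] in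
  [/\ sumn ps = N,
      forall p q : 'I_N, (reshape_index ps p < reshape_index ps q)%N ->
        lt (key p) (key q) &
      forall p q : 'I_N, reshape_index ps p = reshape_index ps q -> key p = key q].
Proof.
move=> lt_irr lt_tr ts_lt ts_all key_mono ps.
pose m t := #|[pred p | key p == t]|.
pose le := [rel x y | (x == y) || lt x y].
have le_tr : transitive le.
  move=> y x z /= /predU1P[->//|xy] /predU1P[<-|yz]; first by rewrite xy orbT.
  by rewrite (lt_tr _ _ _ xy yz) orbT.
have le_anti : antisymmetric le.
  move=> x y /= /andP[/predU1P[//|xy] /predU1P[//|yx]].
  by have := lt_tr _ _ _ xy yx; rewrite lt_irr.
pose ts' := [seq t <- ts | m t != 0%N].
(* Both sides are sorted for [le] and contain every key equally often. *)
have keysE : [seq key p | p <- enum 'I_N] = flatten [seq nseq (m t) t | t <- ts'].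
  apply: (sorted_eq le_tr le_anti).
  - rewrite sorted_map; apply: (sub_sorted (e := relpre val ltn)).
      by move=> p q /= /key_mono.
    by rewrite -sorted_map val_enum_ord iota_ltn_sorted.
  - rewrite sorted_pairwise //; apply: (pairwise_flatten (rS := lt)).
    + move=> t; elim: (m t) => //= d IHd; rewrite IHd andbT.
      by apply/allP => x /nseqP[-> _]; rewrite /= eqxx.
    + move=> a b ab; apply/allrelP => x y /nseqP[-> _] /nseqP[-> _] /=.
      by rewrite ab orbT.
    + exact: pairwise_filter.
  - apply/allP => t _; apply/eqP; rewrite count_map count_flatten -map_comp.
    have -> : [seq (count_mem t \o (fun x => nseq (m x) x)) x | x <- ts'] =
        [seq ((x == t) * m t)%N | x <- ts'].
      by apply: eq_map => x; rewrite /= count_nseq /=; case: eqP => [->|].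
    have -> s c : sumn [seq ((x == t) * c)%N | x <- s] = (count_mem t s * c)%N.
      by elim: s => //= x s ->; rewrite mulnDl.
    have ts_uniq : uniq ts' by apply: filter_uniq; apply: pairwise_uniq ts_lt.
    have mE : m t = count (preim key (pred1 t)) (enum 'I_N).
      by rewrite /m cardE size_filter enumT.
    rewrite count_uniq_mem // mem_filter -mE.
    case: eqVneq => [->|m_neq0] /=; first by rewrite muln0.
    suff -> : t \in ts by rewrite mul1n.
    have /card_gt0P[p /eqP <-] : (0 < m t)%N by rewrite lt0n.
    exact: ts_all.
have psE : ps = shape [seq nseq (m t) t | t <- ts'].
  rewrite /ps /shape filter_map -map_comp; apply: eq_map => t /=.
  by rewrite size_nseq.
have ps_sum : sumn ps = N.
  by rewrite psE -size_flatten -keysE size_map size_enum_ord.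
move: key key_mono ts_all m @ps @ts' keysE psE ps_sum.
(* For positive size, [key ord0] is available as the default of [nth]. *)
case: N => [|N] key key_mono ts_all m ps ts' keysE psE ps_sum.
  by split=> // -[].
have keyE p : key p = nth (key ord0) ts' (reshape_index ps p) /\
    (reshape_index ps p < size ts')%N.
  have r_lt : (reshape_index ps p < size ts')%N.
    by have := @reshape_indexP ps p; rewrite ps_sum ltn_ord psE !size_map; apply.
  split=> //; have -> : key p = nth (key ord0) [seq key p | p <- enum 'I_N.+1] p.
    by rewrite (nth_map ord0) ?size_enum_ord // nth_ord_enum.
  rewrite keysE nth_flatten -psE (nth_map (key ord0)) // nth_nseq.
  have := @reshape_offsetP ps p; rewrite ps_sum ltn_ord => /(_ isT).
  rewrite {2}psE (nth_map [::]) ?size_map // (nth_map (key ord0)) //.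
  by rewrite size_nseq => ->.
split=> // p q; have [-> p_lt] := keyE p; have [-> q_lt] := keyE q.
  move=> pq; have ts'_lt : pairwise lt ts' by apply: pairwise_filter.
  by move/pairwiseP: ts'_lt; apply.
by move->.
Qed.
End Strips.

(** * Keys of the rows of a Weyr form *)

Section WeyrKeys.
Variables (l : nat) (n : 'I_l -> nat).
Local Notation N := (\sum_i n i)%N.

(* Row c (counted from 1) of a Jordan block of size m has key (c, m). *)
Definition row_key (u : 'I_N) : nat * nat := ((tagnat.sig2 u).+1, n (tagnat.sig1 u)).

Definition weyr_key (p : 'I_N) : nat * nat := row_key (weyr_perm n p).

Definition lt_key : rel (nat * nat) :=
  fun x y => (x.1 < y.1)%N || (x.1 == y.1) && (y.2 < x.2)%N.

(** The pattern of [T_stars] in terms of keys: with rows and columns counted from 1, the first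
    column is c = 1 and the last row is c = m. *)
Definition star_key (x y : nat * nat) : bool :=
  if (x.2 < y.2)%N then y.1 == 1%N else x.1 == x.2.

(** The order is that of the sizes in [weyr_partition]. Block sizes that do not occur are included;
    their level sets are the zero members removed there. *)
Definition weyr_keys : seq (nat * nat) :=
  let k := (\max_i n i)%N in
  flatten [seq [seq (g, t) | t <- rev (iota g (k.+1 - g))] | g <- iota 1 k].

Lemma lt_key_irr : irreflexive lt_key.
Proof. by move=> x; rewrite /lt_key !ltnn andbF. Qed.

Lemma lt_key_trans : transitive lt_key.
Proof. by move=> [a b] [c d] [e f]; rewrite /lt_key /=; lia. Qed.

Lemma weyr_keys_lt : pairwise lt_key weyr_keys.
Proof.
apply: (pairwise_flatten (rS := ltn)).
- move=> g; rewrite pairwise_map.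
  apply: (sub_pairwise (r := gtn)) => [a b ba|].
    by rewrite /= /lt_key /= eqxx orbC (ba : (b < a)%N).
  rewrite -sorted_pairwise; last by move=> a b c /=; lia.
  by rewrite rev_sorted iota_ltn_sorted.
- move=> a b ab; apply/allrelP => x y /mapP[c _ ->] /mapP[d _ ->].
  by rewrite /lt_key /= (ab : (a < b)%N).
- by rewrite -sorted_pairwise ?iota_ltn_sorted //; apply: ltn_trans.
Qed.

Lemma mem_weyr_keys x :
  (x \in weyr_keys) = (0 < x.1 <= x.2)%N && (x.2 <= \max_i n i)%N.
Proof.
rewrite /weyr_keys; move: (\max_i n i)%N => k.
apply/flatten_mapP/idP => [[g] |]; case: x => a b.
  rewrite mem_iota => /andP[g0 gk] /mapP[t]; rewrite mem_rev mem_iota => tg [-> ->] /=.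
  lia.
move=> /= H; exists a; first by rewrite mem_iota; lia.
by apply/mapP; exists b => //; rewrite mem_rev mem_iota; lia.
Qed.

Lemma row_key_Rank i (j : 'I_(n i)) : row_key (tagnat.Rank i j) = (j.+1, n i).
Proof.
by congr pair; [rewrite tagnat.Rank2K | rewrite tagnat.Rank1K].
Qed.

Lemma row_key_range u : (0 < (row_key u).1 <= (row_key u).2)%N.
Proof. by rewrite /= ltn_ord. Qed.

Lemma row_key_in u : row_key u \in weyr_keys.
Proof. by rewrite mem_weyr_keys row_key_range (leq_bigmax (tagnat.sig1 u)). Qed.

Lemma nb_blocks_eq t : (nb_blocks_ge n t - nb_blocks_ge n t.+1)%N =
  #|[set i | n i == t]|.
Proof.
rewrite /nb_blocks_ge.
have -> : [set i | (t <= n i)%N]%SET =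
    [set i | n i == t]%SET :|: [set i | (t < n i)%N]%SET.
  by apply/setP => i; rewrite !inE; lia.
rewrite cardsU (_ : (_ :&: _)%SET = finset.set0) ?cards0 ?subn0 ?addnK //.
by apply/setP => i; rewrite !inE; lia.
Qed.

(** Every block of size b >= a has exactly one row with key (a, b), so these rows correspond to the
    blocks of size b. *)
Lemma card_row_key x : x \in weyr_keys ->
  #|[set u | row_key u == x]| = #|[set i | n i == x.2]|.
Proof.
rewrite mem_weyr_keys; case: x => a b /= /andP[/andP[a0 ab] _].
have -> : [set i | n i == b]%SET = tagnat.sig1 @: [set u | row_key u == (a, b)]%SET.
  apply/setP => i; rewrite inE; apply/idP/imsetP => [/eqP ib|[u]]; last first.
    by rewrite inE => /eqP[_ ib] ->; rewrite ib.
  have lt_a : (a.-1 < n i)%N by rewrite ib; lia.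
  exists (tagnat.Rank i (Ordinal lt_a)); last by rewrite tagnat.Rank1K.
  by rewrite inE row_key_Rank /= ib prednK.
rewrite card_in_imset // => u v; rewrite !inE => /eqP[ua _] /eqP[va _] uv.
have s2 : tagnat.sig2 u = tagnat.sig2 v :> nat by apply: succn_inj; rewrite ua va.
by apply/val_inj; rewrite /= [LHS]tagnat.rect [RHS]tagnat.rect s2 uv.
Qed.

Lemma card_weyr_key x : #|[pred p | weyr_key p == x]| = #|[set u | row_key u == x]|.
Proof.
rewrite -(card_imset _ (@perm_inj _ (weyr_perm n))).
apply: eq_card => u; rewrite [RHS]inE; apply/imsetP/idP => [[p px ->]|ux].
  by move: px; rewrite inE.
by exists ((weyr_perm n)^-1%g u); rewrite ?inE /weyr_key permKV.
Qed.

(** [weyr_seq] lists the rows by their index within the block and, for equal indices, in the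
    original order, along which block sizes do not increase. *)
Lemma weyr_key_mono (p q : 'I_N) : jordan_sizes n -> (p < q)%N ->
  (weyr_key p == weyr_key q) || lt_key (weyr_key p) (weyr_key q).
Proof.
move=> n_sizes pq; have sz : size (weyr_seq n) = N.
  by rewrite (perm_size (perm_weyr_seq n)) size_enum_ord.
(* The default of [nth] behind [weyr_perm] varies with the index; here it is made the same for all
   of them. *)
have weyrE r : weyr_perm n r = nth p (weyr_seq n) r.
  by rewrite permE; apply: set_nth_default; rewrite sz.
pose before := [rel u v : 'I_N | (tagnat.sig2 u < tagnat.sig2 v)%N ||
  (tagnat.sig2 u == tagnat.sig2 v :> nat) && (u < v)%N].
have before_pq : before (weyr_perm n p) (weyr_perm n q).
  suff /(pairwiseP p) H : pairwise before (weyr_seq n).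
    by rewrite !weyrE; apply: H => //; rewrite inE sz.
  apply: (pairwise_flatten (rS := ltn)).
  - move=> c; apply/(pairwiseP p) => i j; rewrite !inE => ic jc ij /=.
    have := mem_nth p ic; have := mem_nth p jc; rewrite !mem_filter.
    move=> /andP[/eqP -> _] /andP[/eqP -> _]; rewrite ltnn eqxx /=.
    move: ic jc ij; set s := seq.filter _ _ => ic jc ij.
    have : sorted (relpre val ltn) s.
      apply: sorted_filter => [a b d /=|]; first exact: ltn_trans.
      by rewrite -sorted_map val_enum_ord iota_ltn_sorted.
    have tr : transitive (relpre val ltn : rel 'I_N) by move=> a b d; apply: ltn_trans.
    by move=> /(sorted_ltn_nth tr p) s_lt; apply: s_lt.
  - move=> a b ab; apply/allrelP => u v; rewrite !mem_filter /before /=.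
    by move=> /andP[/eqP -> _] /andP[/eqP -> _]; rewrite (ab : (a < b)%N).
  - by rewrite -sorted_pairwise ?iota_ltn_sorted //; apply: ltn_trans.
rewrite /weyr_key; move: (weyr_perm n p) (weyr_perm n q) before_pq => u v /=.
have [_ _ n_mono] := n_sizes; rewrite /row_key /lt_key xpair_eqE /= ltnS eqSS.
case/orP=> [-> | /andP[-> uv]]; first by rewrite orbT.
have /n_mono := tagnat.le_sig1 (ltnW uv); rewrite leq_eqVlt eq_sym.
by case/orP=> ->; rewrite ?orbT.
Qed.

(** Identifies the differences s_t - s_{t+1} with the sizes of level sets, the form in which
    [strips_of_key] applies. *)
Lemma weyr_partitionE : weyr_partition n =
  [seq d <- [seq #|[pred p | weyr_key p == x]| | x <- weyr_keys] | d != 0%N].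
Proof.
rewrite /weyr_partition; congr (seq.filter _ _).
rewrite (eq_in_map _ (fun x => nb_blocks_ge n x.2 - nb_blocks_ge n x.2.+1)%N _).1 => [|x].
  by rewrite map_flatten -map_comp; congr flatten; apply: eq_map => g /=; rewrite -map_comp.
by move=> /card_row_key H; rewrite card_weyr_key H nb_blocks_eq.
Qed.

Lemma H_starsE (u v : 'I_N) : H_stars n u v = star_key (row_key u) (row_key v).
Proof. by rewrite !mxE. Qed.

(** Let the keys be (a, b) < (c, d). If a < c, then c > 1, and d <= b would give a < c <= d <= b; if
    a = c and d < b, then a <= d < b. Neither case meets the star condition. *)
Lemma lt_key_star (u v : 'I_N) : lt_key (row_key u) (row_key v) -> ~~ H_stars n u v.
Proof.
rewrite H_starsE; have := row_key_range u; have := row_key_range v.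
case: (row_key u) (row_key v) => [a b] [c d]; rewrite /lt_key /star_key /=.
by case: ifP; lia.
Qed.

End WeyrKeys.

(** * Weyr deformations *)

Section BlockTriangular.
Variable R : realType.
Local Notation C := (cplx R).

Lemma fill_pos_uniq (K : fieldType) k n (pos : 'I_k -> 'I_n * 'I_n)
    (a : 'rV[K]_k) (M : 'M[K]_n) : injective pos ->
  (forall t, M (pos t).1 (pos t).2 = a 0 t) ->
  (forall i j, (i, j) \notin codom pos -> M i j = 0) -> M = fill_pos pos a.
Proof.
move=> pos_inj Ma M0; rewrite -[LHS](read_posK pos_inj).
  by congr fill_pos; apply/rowP => t; rewrite mxE Ma.
by move=> i j; rewrite mxE => /M0.
Qed.

Lemma simple_at_fill_pos k n (A : 'M[C]_n) (pos : 'I_k -> 'I_n * 'I_n) :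
  injective pos -> simple_at A (fun a => A + fill_pos pos a) pos.
Proof.
move=> pos_inj; split=> //; apply/near0_rnormP; exists 1 => [|a _]; rewrite ?ltr01 //.
rewrite [A + _]addrC addrK; split=> [t|i j ij]; first exact: fill_posE.
exact: fill_pos_out.
Qed.

Lemma lower_triangular_fill_pos k n (pos : 'I_k -> 'I_n * 'I_n) ps (a : 'rV[C]_k) :
  sumn ps = n ->
  (forall i j : 'I_n, (reshape_index ps i < reshape_index ps j)%N ->
    (i, j) \notin codom pos) ->
  lower_block_triangular ps (fill_pos pos a).
Proof. by move=> ps_sum low; split=> // i j /low; apply: fill_pos_out. Qed.

Lemma block_triangular_fill_pos k n (A : 'M[C]_n) (pos : 'I_k -> 'I_n * 'I_n) ps :
  injective pos -> sumn ps = n ->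
  (forall i j : 'I_n, (reshape_index ps i < reshape_index ps j)%N ->
    (i, j) \notin codom pos) ->
  (forall i i' j j' : 'I_n, reshape_index ps i = reshape_index ps i' ->
    reshape_index ps j = reshape_index ps j' ->
    ((i, j) \in codom pos) = ((i', j') \in codom pos)) ->
  block_triangular_deformation ps A (fun a => A + fill_pos pos a).
Proof.
move=> pos_inj ps_sum low full; split; first exact: deformation_fill_pos.
exists pos; split; first exact: simple_at_fill_pos.
  left; apply/near0_rnormP; exists 1 => [|a _]; rewrite ?ltr01 //.
  rewrite [A + _]addrC addrK.
  exact: lower_triangular_fill_pos.
(* A block either contains a star, which [full] spreads over the block, or contains none. *)
move=> b c; have [[i [j [ib jc ij]]]|none] := pselect (exists i j : 'I_n,
    [/\ reshape_index ps i = b, reshape_index ps j = c & (i, j) \in codom pos]).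
  right=> i' j' [ib' jc']; rewrite -(full i i' j j') ?ib ?jc //.
by left=> i j [ib jc]; apply/negP => ij; apply: none; exists i, j.
Qed.

End BlockTriangular.

(** * Deformations for a single eigenvalue *)

Section WeyrDeformation.
Variable l : nat.
Implicit Type n : 'I_l -> nat.

(** Row p of the Weyr form is row [weyr_perm n p] of the Jordan matrix, so the stars move by the
    inverse permutation. *)
Definition weyr_pos n (t : 'I_(nb_params n)) : 'I_(\sum_i n i) * 'I_(\sum_i n i) :=
  let s := ((weyr_perm n)^-1)%g in (s (enum_val t).1, s (enum_val t).2).

Lemma weyr_pos_inj n : injective (@weyr_pos n).
Proof.
move=> t u [/perm_inj e1 /perm_inj e2]; apply: enum_val_inj.
by rewrite [LHS]surjective_pairing e1 e2 -surjective_pairing.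
Qed.

Lemma mem_weyr_pos n p q :
  ((p, q) \in codom (@weyr_pos n)) = star_key (weyr_key p) (weyr_key q).
Proof.
rewrite /weyr_key -H_starsE; apply/codomP/idP => [[t [-> ->]]|st].
  by rewrite !permKV; have := enum_valP t; rewrite inE.
have st' : (weyr_perm n p, weyr_perm n q) \in star_set (H_stars n) by rewrite inE.
by exists (enum_rank_in st' (weyr_perm n p, weyr_perm n q));
  rewrite /weyr_pos enum_rankK_in //= !permK.
Qed.

Lemma pos_stars_weyr n : pos_stars (@weyr_pos n) = to_weyr (H_stars n).
Proof. by apply/matrixP => p q; rewrite !mxE mem_weyr_pos /weyr_key -H_starsE !mxE. Qed.

Lemma to_weyr_arnold_H (K : fieldType) n (a : 'rV[K]_(nb_params n)) :
  to_weyr (arnold_H a) = fill_pos (@weyr_pos n) a.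
Proof.
have arnoldE : arnold_H a = fill_pos (fun t : 'I_(nb_params n) => enum_val t) a by [].
apply: fill_pos_uniq => [|t|p q]; first exact: weyr_pos_inj.
  by rewrite !mxE !permKV arnoldE fill_posE //; apply: enum_val_inj.
rewrite mem_weyr_pos /weyr_key -H_starsE => st; rewrite !mxE arnoldE.
apply: fill_pos_out; apply: contra st => /codomP[t eq_t].
by have := enum_valP t; rewrite -eq_t inE.
Qed.

Lemma to_weyr_arnold_deformation (K : fieldType) n (lambda : K) a :
  to_weyr (arnold_deformation lambda a) = weyr_form n lambda + fill_pos (@weyr_pos n) a.
Proof. by rewrite -to_weyr_arnold_H; apply/matrixP => p q; rewrite !mxE. Qed.

Lemma transversal_weyr_eq (K : fieldType) n (lambda : K) :
  transversal (weyr_form n lambda) (weyr_form n lambda) (to_weyr (H_stars n)).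
Proof.
apply: transversal_perm; apply: transversal_mxdiag => i j.
exact: transversal_jordan_eq.
Qed.

Lemma transversal_weyr_neq (K : fieldType) m n (n' : 'I_m -> nat) (lambda mu : K) :
  lambda != mu ->
  transversal (weyr_form n lambda) (weyr_form n' mu) (const_mx false).
Proof.
move=> neq_lm; have := @transversal_perm K _ _ _ _ _ (weyr_perm n) (weyr_perm n')
  (transversal_mxdiag (fun i j => transversal_jordan_neq (n i) (n' j) neq_lm)).
by congr (transversal _ _ _); apply/matrixP => p q; rewrite !mxE.
Qed.

Lemma weyr_strips n : jordan_sizes n ->
  let r (p : 'I_(\sum_i n i)) := reshape_index (weyr_partition n) p in
  [/\ sumn (weyr_partition n) = (\sum_i n i)%N,
      forall p q, (r p < r q)%N -> (p, q) \notin codom (@weyr_pos n) &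
      forall p p' q q', r p = r p' -> r q = r q' ->
        ((p, q) \in codom (@weyr_pos n)) = ((p', q') \in codom (@weyr_pos n))].
Proof.
move=> n_sizes r; have [ps_sum ps_lt ps_eq] := strips_of_key (key := @weyr_key l n)
  lt_key_irr lt_key_trans (weyr_keys_lt n) (fun p => row_key_in _)
  (fun p q => @weyr_key_mono l n p q n_sizes).
rewrite /r weyr_partitionE; split=> // [p q /ps_lt|p p' q q' /ps_eq pp' /ps_eq qq'].
  by rewrite mem_weyr_pos /weyr_key => /lt_key_star; rewrite H_starsE.
by rewrite !mem_weyr_pos pp' qq'.
Qed.

End WeyrDeformation.

(** * Direct sums over several eigenvalues *)

Section WeyrSum.
Variables (tau : nat) (l : 'I_tau -> nat) (n : forall i : 'I_tau, 'I_(l i) -> nat).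
Local Notation N u := (\sum_(j < l u) @n u j)%N.
Local Notation NN := (\sum_(i < tau) \sum_(j < l i) @n i j)%N.

Definition sum_pos (s : 'I_(\sum_(i < tau) nb_params (@n i))) : 'I_NN * 'I_NN :=
  let x := tagnat.sig s in
  (tagnat.Rank (tag x) (weyr_pos (tagged x)).1,
   tagnat.Rank (tag x) (weyr_pos (tagged x)).2).

Lemma sum_pos_Rank u (t : 'I_(nb_params (@n u))) :
  sum_pos (tagnat.Rank u t) =
  (tagnat.Rank u (weyr_pos t).1, tagnat.Rank u (weyr_pos t).2).
Proof. by rewrite /sum_pos /tagnat.Rank tagnat.rankK. Qed.

Lemma Rank_inj m (p : 'I_m -> nat) u : injective (@tagnat.Rank m p u).
Proof.
move=> x y /(congr1 val)/= /eqP.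
by rewrite tagnat.eq_Rank eqxx => /eqP/val_inj.
Qed.

Lemma sum_pos_inj : injective sum_pos.
Proof.
move=> s s'; rewrite -[s]tagnat.sig2K -[s']tagnat.sig2K !sum_pos_Rank.
move: (tagnat.sig1 s) (tagnat.sig2 s) (tagnat.sig1 s') (tagnat.sig2 s').
move=> u t u' t' /pair_equal_spec[e1 e2].
have := congr1 tagnat.sig1 e1; rewrite !tagnat.Rank1K => uu'.
case: _ / uu' t' e1 e2 => t' /Rank_inj e1 /Rank_inj e2; congr tagnat.Rank.
by apply: weyr_pos_inj; rewrite [LHS]surjective_pairing e1 e2 -surjective_pairing.
Qed.

(** With the summand as leading component, the level sets are the strips of the concatenated
    partition. *)
Definition sum_key (p : 'I_NN) : 'I_tau * (nat * nat) :=
  (tagnat.sig1 p, weyr_key (tagnat.sig2 p)).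

Lemma sum_key_Rank u (p : 'I_(N u)) : sum_key (tagnat.Rank u p) = (u, weyr_key p).
Proof.
rewrite /sum_key /tagnat.sig2 /tagnat.sig1 /tagnat.Rank.
by move: (tagnat.rankK (Tagged (fun u => 'I_(N u)) p)) => ->.
Qed.

Definition sum_star : rel ('I_tau * (nat * nat)) :=
  fun x y => (x.1 == y.1) && star_key x.2 y.2.

Lemma mem_sum_pos p q :
  ((p, q) \in codom sum_pos) = sum_star (sum_key p) (sum_key q).
Proof.
rewrite -[p]tagnat.sig2K -[q]tagnat.sig2K !sum_key_Rank.
move: (tagnat.sig1 p) (tagnat.sig2 p) (tagnat.sig1 q) (tagnat.sig2 q).
move=> u {}p v {}q; apply/codomP/andP => /= [[s]|[/eqP uv]].
  rewrite -[s]tagnat.sig2K sum_pos_Rank.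
  move: (tagnat.sig1 s) (tagnat.sig2 s) => w t.
  move=> /pair_equal_spec[/(congr1 sum_key) + /(congr1 sum_key)].
  rewrite !sum_key_Rank => /pair_equal_spec[uw ->] /pair_equal_spec[vw ->].
  rewrite uw vw eqxx -mem_weyr_pos.
  by rewrite -surjective_pairing codom_f.
case: _ / uv q => q; rewrite -mem_weyr_pos => /codomP[t pq].
by exists (tagnat.Rank u t); rewrite sum_pos_Rank -pq.
Qed.

Lemma fill_sum_pos (K : fieldType) (a : 'rV[K]_(\sum_(i < tau) nb_params (@n i))) :
  \mxdiag_(i < tau) fill_pos (@weyr_pos _ (@n i)) (submxrow a i) = fill_pos sum_pos a.
Proof.
(* The [conform_mx] comes from [\mxdiag], whose diagonal blocks are cast to the type of a general
   block. *)
have diagE u v (p : 'I_(N u)) (q : 'I_(N v)) :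
    (\mxdiag_(i < tau) fill_pos (@weyr_pos _ (@n i)) (submxrow a i))
      (tagnat.Rank u p) (tagnat.Rank v q) =
    (if u == v then conform_mx 0 (fill_pos (@weyr_pos _ (@n u)) (submxrow a u))
     else 0) p q.
  by have /matrixP/(_ p q) := mxblockK (fun i j => if i == j then
    conform_mx (0 : 'M[K]_(N i, N j)) (fill_pos (@weyr_pos _ (@n i)) (submxrow a i))
    else 0) u v;
     rewrite mxE.
apply: fill_pos_uniq => [|s|p q]; first exact: sum_pos_inj.
  rewrite -[s]tagnat.sig2K sum_pos_Rank diagE eqxx conform_mx_id.
  by rewrite fill_posE ?mxE //; apply: weyr_pos_inj.
rewrite -[p]tagnat.sig2K -[q]tagnat.sig2K mem_sum_pos !sum_key_Rank.
move: (tagnat.sig1 p) (tagnat.sig2 p) (tagnat.sig1 q) (tagnat.sig2 q).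
move=> u {}p v {}q; rewrite diagE /sum_star /=; case: eqVneq => [uv|_ _]; last by rewrite mxE.
case: _ / uv q => q; rewrite conform_mx_id -mem_weyr_pos; exact: fill_pos_out.
Qed.

Lemma weyr_arnold_sumE (K : fieldType) (lambda : 'I_tau -> K) a :
  weyr_arnold_sum n lambda a = weyr_sum n lambda + fill_pos sum_pos a.
Proof.
rewrite -fill_sum_pos -mxdiagD; apply: eq_mxdiag => u.
exact: to_weyr_arnold_deformation.
Qed.

(** Diagonal blocks carry the Arnold stars; off-diagonal blocks pair distinct eigenvalues and carry
    none. *)
Lemma transversal_weyr_sum (K : fieldType) (lambda : 'I_tau -> K) :
  injective lambda ->
  transversal (weyr_sum n lambda) (weyr_sum n lambda) (pos_stars sum_pos).
Proof.
move=> lambda_inj.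
have -> : pos_stars sum_pos = \mxblock_(u < tau, v < tau)
    \matrix_(p < N u, q < N v) ((u == v) && star_key (weyr_key p) (weyr_key q)).
  by apply/matrixP => p q; rewrite !mxE mem_sum_pos.
apply: transversal_mxdiag => u v; case: (eqVneq u v) => [<-|uv].
  have := transversal_weyr_eq (@n u) (lambda u); congr (transversal _ _ _).
  by rewrite -pos_stars_weyr; apply/matrixP => p q; rewrite !mxE mem_weyr_pos.
have := @transversal_weyr_neq _ K _ (@n u) (@n v) _ _ (contra_neq (@lambda_inj u v) uv).
by congr (transversal _ _ _); apply/matrixP => p q; rewrite !mxE.
Qed.

Definition lt_sum_key : rel ('I_tau * (nat * nat)) :=
  fun x y => (x.1 < y.1)%N || (x.1 == y.1) && lt_key x.2 y.2.

Lemma sum_strips : (forall i, jordan_sizes (@n i)) ->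
  let r (p : 'I_NN) := reshape_index (weyr_partition_sum n) p in
  [/\ sumn (weyr_partition_sum n) = NN,
      forall p q, (r p < r q)%N -> (p, q) \notin codom sum_pos &
      forall p p' q q', r p = r p' -> r q = r q' ->
        ((p, q) \in codom sum_pos) = ((p', q') \in codom sum_pos)].
Proof.
move=> n_sizes r.
pose ts := flatten [seq [seq (u, x) | x <- weyr_keys (@n u)] | u <- enum 'I_tau].
have lt_irr : irreflexive lt_sum_key.
  by move=> x; rewrite /lt_sum_key ltnn lt_key_irr andbF.
have lt_tr : transitive lt_sum_key.
  move=> [v y] [u x] [w z]; rewrite /lt_sum_key /=.
  case/orP=> [uv|/andP[/eqP -> xy]] /orP[vw|/andP[/eqP <- yz]].
  - by rewrite (ltn_trans uv vw).
  - by rewrite uv.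
  - by rewrite vw.
  - by rewrite eqxx (lt_key_trans xy yz) orbT.
have ts_lt : pairwise lt_sum_key ts.
  apply: (pairwise_flatten (rS := relpre val ltn)).
  - move=> u; rewrite pairwise_map; apply: sub_pairwise (weyr_keys_lt (@n u)).
    by move=> x y xy; rewrite /= /lt_sum_key eqxx xy orbT.
  - move=> u v uv; apply/allrelP => x y /mapP[x' _ ->] /mapP[y' _ ->].
    by rewrite /lt_sum_key (uv : (u < v)%N).
  - rewrite -sorted_pairwise; last by move=> a b d /=; apply: ltn_trans.
    by rewrite -sorted_map val_enum_ord iota_ltn_sorted.
have ts_all p : sum_key p \in ts.
  apply/flatten_mapP; exists (tagnat.sig1 p); first by rewrite mem_enum.
  by apply/mapP; exists (weyr_key (tagnat.sig2 p)); rewrite ?row_key_in.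
have key_mono (p q : 'I_NN) : (p < q)%N ->
    (sum_key p == sum_key q) || lt_sum_key (sum_key p) (sum_key q).
  move=> pq.
  have le1 : (tagnat.sig1 p <= tagnat.sig1 q)%N := tagnat.le_sig1 (ltnW pq).
  move: pq le1.
  rewrite -[p]tagnat.sig2K -[q]tagnat.sig2K !sum_key_Rank !tagnat.Rank1K.
  move: (tagnat.sig1 p) (tagnat.sig2 p) (tagnat.sig1 q) (tagnat.sig2 q).
  move=> u {}p v {}q pq; rewrite leq_eqVlt => /predU1P[/val_inj uv|uv]; last first.
    by rewrite /lt_sum_key uv orbT.
  case: _ / uv q pq => q; rewrite !tagnat.RankEsum ltn_add2l.
  move=> /(weyr_key_mono (n_sizes u)); move: (weyr_key p) (weyr_key q) => x y.
  by rewrite /lt_sum_key xpair_eqE eqxx /= => /orP[->|->]; rewrite ?orbT.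
have [ps_sum ps_lt ps_eq] := strips_of_key lt_irr lt_tr ts_lt ts_all key_mono.
(* Within summand u, [tagnat.Rank u] maps the level set of x bijectively onto that of (u, x). *)
have psE : weyr_partition_sum n =
    [seq d <- [seq #|[pred p | sum_key p == t]| | t <- ts] | d != 0%N].
  rewrite /weyr_partition_sum map_flatten filter_flatten -!map_comp.
  congr flatten; apply: eq_map => u /=; rewrite weyr_partitionE -map_comp.
  congr (seq.filter _ _); apply: eq_map => x /=.
  rewrite -(card_imset _ (@Rank_inj _ (fun v => N v) u)); apply: eq_card => p.
  rewrite [RHS]inE; apply/imsetP/eqP => [[q qx ->]|].
    by move: qx; rewrite inE sum_key_Rank => /eqP ->.
  rewrite -[p]tagnat.sig2K sum_key_Rank.
  move: (tagnat.sig1 p) (tagnat.sig2 p) => v {}p [vu px].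
  by case: _ / vu x px => x px; exists p; rewrite // inE px.
rewrite /r psE; split=> // [p q /ps_lt|p p' q q' /ps_eq pp' /ps_eq qq']; last first.
  by rewrite !mem_sum_pos pp' qq'.
(* Between different summands there is no star; within one summand [lt_key_star] applies. *)
rewrite mem_sum_pos /lt_sum_key /sum_star.
rewrite -[p]tagnat.sig2K -[q]tagnat.sig2K !sum_key_Rank /=.
move: (tagnat.sig1 p) (tagnat.sig2 p) (tagnat.sig1 q) (tagnat.sig2 q).
move=> u {}p v {}q; case: eqVneq => [uv|//].
case: _ / uv q => q; rewrite ltnn /= => /lt_key_star.
by rewrite H_starsE.
Qed.

End WeyrSum.

Theorem theorem2p5 (R : realType) :
  (forall (l : nat) (n : 'I_l -> nat) (lambda : cplx R),
     jordan_sizes n ->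
     miniversal (weyr_form n lambda)
       (fun a : 'rV[cplx R]_(nb_params n) =>
          to_weyr (arnold_deformation lambda a)) /\
     forall a : 'rV[cplx R]_(nb_params n),
       lower_block_triangular (weyr_partition n) (to_weyr (arnold_H a))) /\
  (forall (tau : nat) (l : 'I_tau -> nat) (n : forall i : 'I_tau, 'I_(l i) -> nat)
          (lambda : 'I_tau -> cplx R),
     (0 < tau)%N ->
     (forall i : 'I_tau, jordan_sizes (n i)) ->
     injective lambda ->
     [/\ miniversal (weyr_sum n lambda) (weyr_arnold_sum n lambda),
         simple_deformation (weyr_sum n lambda) (weyr_arnold_sum n lambda) &
         block_triangular_deformation (weyr_partition_sum n)
           (weyr_sum n lambda) (weyr_arnold_sum n lambda)]).
Proof.
split=> [l n lambda n_sizes|tau l n lambda _ n_sizes lambda_inj].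
  have [ps_sum low _] := weyr_strips n_sizes; split=> [|a]; last first.
    by rewrite to_weyr_arnold_H; apply: lower_triangular_fill_pos.
  rewrite (funext (to_weyr_arnold_deformation lambda)).
  apply: miniversal_fill_pos; first exact: weyr_pos_inj.
  by rewrite pos_stars_weyr; apply: transversal_weyr_eq.
have [ps_sum low full] := sum_strips n_sizes.
rewrite (funext (weyr_arnold_sumE lambda)); split.
- apply: miniversal_fill_pos; first exact: sum_pos_inj.
  exact: transversal_weyr_sum.
- split; first exact: deformation_fill_pos.
  by exists (@sum_pos _ _ n); apply: simple_at_fill_pos; apply: sum_pos_inj.
- by apply: block_triangular_fill_pos => //; apply: sum_pos_inj.
Qed.
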